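(* Let $G$ be a compact group and let $K$ be a homogeneous $G$-space. Then the following assertions are equivalent: (1) The action of $G$ on $K$ is multiplicity-free. (2) Every finite-dimensional $G$-invariant subspace $S\subset C(K)$ is $G$-accessible.
   Context: All function spaces and representations are complex. A homogeneous $G$-space is a compact Hausdorff space $K$ with a continuous transitive left action $(g,x)\mapsto g\bullet x$ of the compact group $G$; $\mu_K$ is the unique $G$-invariant regular Borel probability measure on $K$. Put $(L_gf)(x)=f(g^{-1}\bullet x)$; $S\subset C(K)$ is $G$-invariant if $L_g(S)\subset S$ for all $g$. A (bounded linear) projection $Q\colon C(K)\to S$ is $G$-equivariant if $QL_g=L_gQ$ for all $g\in G$. A finite-dimensional $G$-invariant subspace $S\subset C(K)$ is $G$-accessible if every $G$-equivariant projection $Q\colon C(K)\to S$ coincides with the restriction to $C(K)$ of the orthogonal projection $L_2(K,\mu_K)\to S$. $\widehat G$ is the set of equivalence classes of irreducible unitary representations $\pi\colon G\to\mathcal U(V_\pi)$. For a base point $x_0\in K$ with stabilizer $H_{x_0}=\{h\in G:h\bullet x_0=x_0\}$, $m_\pi(K)=\dim\{u\in V_\pi:\pi(h)u=u\ \forall h\in H_{x_0}\}$ (independent of $x_0$). The action of $G$ on $K$ (the pair $(G,K)$) is multiplicity-free if $m_\pi(K)\le1$ for every $\pi\in\widehat G$. *)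

(* Defs.v *)
From HB Require Import structures.
From mathcomp Require Import all_boot all_order all_algebra.
From mathcomp Require Import monoid sesquilinear.
From mathcomp Require Import all_classical all_reals all_analysis.
From mathcomp Require Import complex.

Set Implicit Arguments.
Unset Strict Implicit.
Unset Printing Implicit Defensive.

Import Order.TTheory GRing.Theory Num.Theory.
Import numFieldNormedType.Exports.

Local Open Scope classical_set_scope.
Local Open Scope ring_scope.

HB.mixin Record isTopologicalGroup G & Group G & Topological G := {
  mulg_continuous : continuous (fun p : G * G => (p.1 * p.2)%g);
  invg_continuous : continuous (fun g : G => (g^-1)%g)
}.

#[short(type="topologicalGroupType")]
HB.structure Definition TopologicalGroup :=
  {G of Group G & Topological G & isTopologicalGroup G}.

(* The library's topology and norm are found on the carrier of a numFieldType
   structure, not on the bare type R[i], hence this packaged alias. *)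
Definition Cplx (R : realType) : numClosedFieldType := R[i]%C.

Section ContinuousFunctions.
Variables (R : realType) (K : topologicalType).

Definition Cfun := continuousType K (Cplx R).
HB.instance Definition _ := Choice.on Cfun.

Definition is_cts : {pred K -> Cplx R} := mem [set f | continuous f].

Lemma cts_submod_closed : submod_closed is_cts.
Proof.
split; first by apply/mem_set => x; exact: cst_continuous.
move=> c f g /set_mem fc /set_mem gc; apply/mem_set => x.
by apply: cvgD; [apply: cvgZl_tmp; exact: fc | exact: gc].
Qed.

HB.instance Definition _ :=
  GRing.isSubmodClosed.Build _ _ is_cts cts_submod_closed.

Definition to_Cfun (f : K -> Cplx R) (fc : f \in is_cts) : Cfun :=
  mkcts (set_mem fc).

Lemma Cfun_rect (P : Cfun -> Type) :
  (forall f (fc : f \in is_cts), P (to_Cfun fc)) -> forall u, P u.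
Proof.
move=> Pf u; have uc : (u : K -> Cplx R) \in is_cts.
  by apply/mem_set; exact: cts_fun.
suff -> : u = to_Cfun uc by [].
exact/continuousEP.
Qed.

Lemma Cfun_val (f : K -> Cplx R) (fc : f \in is_cts) :
  (to_Cfun fc : K -> Cplx R) = f.
Proof. by []. Qed.

HB.instance Definition _ := @isSub.Build (K -> Cplx R) is_cts Cfun
  (fun f : Cfun => f : K -> Cplx R) to_Cfun Cfun_rect Cfun_val.

HB.instance Definition _ := [SubChoice_isSubLmodule of Cfun by <:].
End ContinuousFunctions.

Section LinearAlgebra.
Variables (R : realType) (V : lmodType (Cplx R)).

Definition span (n : nat) (e : 'I_n -> V) : set V :=
  [set v | exists c : 'I_n -> Cplx R, v = \sum_(i < n) c i *: e i].

Definition finite_dim_subspace (S : set V) : Prop :=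
  exists (n : nat) (e : 'I_n -> V), S = span e.

Definition lin_indep (n : nat) (e : 'I_n -> V) : Prop :=
  forall c : 'I_n -> Cplx R,
    \sum_(i < n) c i *: e i = 0 -> forall i, c i = 0.

(* The value is +oo when W is infinite-dimensional. *)
Definition dimension (W : set V) : \bar R :=
  ereal_sup [set (n%:R)%:E | n in [set n : nat |
    exists e : 'I_n -> V, (forall i, W (e i)) /\ lin_indep e]].
End LinearAlgebra.

Section UnitaryRepresentations.
Variables (R : realType) (G : topologicalGroupType).

(* [inner] is linear in its first and conjugate-linear in its second argument;
   [inner_norm] makes the complete norm the Hilbert norm. *)
Record hilbertSpace := HilbertSpace {
  hilbert_sort :> completeNormedModType (Cplx R);
  inner : {dot hilbert_sort for @Num.conj (Cplx R)};
  inner_norm : forall v : hilbert_sort, `|v| ^+ 2 = inner v v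
}.

Record unitary_rep (V : hilbertSpace) := UnitaryRep {
  rep :> G -> {linear V -> V};
  rep1 : forall v, rep 1%g v = v;
  repM : forall g h v, rep (g * h)%g v = rep g (rep h v);
  rep_unitary : forall g u v, inner V (rep g u) (rep g v) = inner V u v;
  (* continuity for the strong operator topology *)
  rep_continuous : forall v, continuous (fun g => rep g v)
}.

Definition irreducible (V : hilbertSpace) (pi : unitary_rep V) : Prop :=
  (exists v : V, v != 0) /\
  forall W : set V,
    closed W -> W 0 ->
    (forall c u v, W u -> W v -> W (c *: u + v)) ->
    (forall g v, W v -> W (pi g v)) ->
    W = [set 0] \/ W = setT.

Definition fixed_vectors (V : hilbertSpace) (pi : unitary_rep V) (H : set G) :
    set V :=
  [set u | forall h, H h -> pi h u = u].
End UnitaryRepresentations.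

Record transitive_action (G : topologicalGroupType) (K : topologicalType) :=
  TransitiveAction {
  act :> G -> K -> K;
  act1 : forall x, act 1%g x = x;
  actM : forall g h x, act (g * h)%g x = act g (act h x);
  act_continuous : continuous (fun p : G * K => act p.1 p.2);
  act_transitive : forall x y, exists g, act g x = y
}.

Definition stabilizer (G : topologicalGroupType) (K : topologicalType)
    (a : transitive_action G K) (x0 : K) : set G :=
  [set h | a h x0 = x0].

Definition multiplicity (R : realType) (G : topologicalGroupType)
    (K : topologicalType) (a : transitive_action G K) (x0 : K)
    (V : hilbertSpace R) (pi : unitary_rep G V) : \bar R :=
  dimension (fixed_vectors pi (stabilizer a x0)).

Definition multiplicity_free (R : realType) (G : topologicalGroupType)
    (K : topologicalType) (a : transitive_action G K) (x0 : K) : Prop :=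
  forall (V : hilbertSpace R) (pi : unitary_rep G V),
    irreducible pi -> (multiplicity a x0 pi <= 1)%E.

Section Translation.
Variables (R : realType) (G : topologicalGroupType) (K : topologicalType).
Variable a : transitive_action G K.

Lemma act_cts (g : G) : continuous (a g).
Proof.
move=> x; apply: (@continuous_comp _ _ _ (fun y : K => (g, y))
  (fun p : G * K => a p.1 p.2)); last exact: act_continuous.
by apply: cvg_pair; [exact: cvg_cst | exact: cvg_id].
Qed.

Lemma translate_cts (g : G) (f : Cfun R K) : continuous (f \o a (g^-1)%g).
Proof. by move=> x; apply: continuous_comp; [exact: act_cts | exact: cts_fun]. Qed.

Definition translate (g : G) (f : Cfun R K) : Cfun R K :=
  mkcts (@translate_cts g f).

Definition invariant_subset (S : set (Cfun R K)) : Prop :=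
  forall g f, S f -> S (translate g f).
End Translation.

(* g_sigma_algebraType carries a measurable structure only over pointed types,
   hence ptopologicalType; the chosen point plays no other role. *)
Definition borel (K : ptopologicalType) := g_sigma_algebraType (@open K).

Section Accessibility.
Variables (R : realType) (G : topologicalGroupType) (K : ptopologicalType).
Variables (a : transitive_action G K) (mu : probability (borel K) R).

Definition regular_measure : Prop :=
  forall A : set (borel K), measurable A ->
    mu A = ereal_inf [set mu U | U in [set U : set K | open U /\ A `<=` U]] /\
    mu A = ereal_sup [set mu F | F in [set F : set K | compact F /\ F `<=` A]].

Definition invariant_measure : Prop :=
  forall (g : G) (A : set (borel K)), measurable A -> mu (a g @` A) = mu A.

Definition L2fun (f : borel K -> Cplx R) : Prop :=
  (fun x => complex.Re (f x)) \in Lfun mu 2%:E /\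
  (fun x => complex.Im (f x)) \in Lfun mu 2%:E.

Definition L2inner (f g : borel K -> Cplx R) : Cplx R :=
  Complex (\int[mu]_x complex.Re (f x * (g x)^*))%R
          (\int[mu]_x complex.Im (f x * (g x)^*))%R.

Definition L2_orthogonal_projection (S : set (Cfun R K))
    (P : (borel K -> Cplx R) -> Cfun R K) : Prop :=
  forall f, L2fun f ->
    S (P f) /\ forall s : Cfun R K, S s -> L2inner (fun x => f x - P f x) s = 0.

Record equivariant_projection (S : set (Cfun R K))
    (Q : {linear Cfun R K -> Cfun R K}) : Prop := {
  proj_range : forall f, S (Q f);
  proj_id : forall f, S f -> Q f = f;
  proj_bounded : exists M : Cplx R, forall (f : Cfun R K) (c : Cplx R),
    (forall x, `|f x| <= c) -> forall x, `|Q f x| <= M * c;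
  proj_equivariant : forall g f, Q (translate a g f) = translate a g (Q f)
}.

(* P is unique up to its values outside L2: s in S orthogonal to S vanishes, as
   an invariant measure on a compact homogeneous space has full support. *)
Definition accessible (S : set (Cfun R K)) : Prop :=
  exists2 P, L2_orthogonal_projection S P &
    forall Q, equivariant_projection S Q -> forall f : Cfun R K, Q f = P f.
End Accessibility.

(* Main.v *)
(* Write H for the stabilizer of x0 and L2 for L2(K, mu).

   Multiplicity-free implies accessible.  If E is an equivariant linear
   endomorphism of C(K) and S is an irreducible invariant subspace of finite
   dimension, then s |-> s(x0) and s |-> (E s)(x0) are H-fixed functionals on S,
   hence proportional, so that E S is contained in S; by induction on the
   dimension this holds for every invariant S of finite dimension.  Let Q be an
   equivariant projection onto S.  The invariant pseudometric
   d(x, y) = sup_g |f(g x) - f(g y)| yields invariant kernels k which approximate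
   the identity at f, and E s : y |-> <s, Q k(., y)> is equivariant, so E s lies
   in S.  If f is orthogonal to S then <Q f, s>, which is close to <f, E s> = 0,
   vanishes for every s in S, so Q f = 0.

   Accessible implies multiplicity-free.  For a fixed vector u of an irreducible
   unitary representation V, put (T_u v)(g x0) = <v, pi(g) u>.  The form
   |T_u v|^2 in L2 attains its maximum lambda on the unit sphere, and its
   maximizers span a closed invariant subspace, so |T_u v|^2 = lambda |v|^2 on V.
   Bessel's inequality bounds the size of orthonormal families by
   |u|^2 / lambda, hence V has finite dimension.  By polarization
   <T_u v, T_u' w> = c(u, u') <v, w>, so independent fixed vectors can be chosen
   with c(u, u') = 0, and then T_u T_u^* / lambda and T_u (T_u / lambda + T_u')^*
   are two distinct equivariant projections onto T_u V. *)

From HB Require Import structures.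
From mathcomp Require Import all_boot all_order all_algebra.
From mathcomp Require Import finmap monoid sesquilinear.
From mathcomp Require Import all_classical all_reals all_analysis.
From mathcomp Require Import measurable_realfun ess_sup_inf complex.
From mathcomp Require Import ring lra.
Require Import Defs.

Set Implicit Arguments.
Unset Strict Implicit.
Unset Printing Implicit Defensive.

Import Order.TTheory GRing.Theory Num.Theory.
Import numFieldNormedType.Exports.

Local Open Scope classical_set_scope.
Local Open Scope ring_scope.

(** * Orthonormal families *)

Section Orthonormal.
Variables (R : realType) (V : lmodType (Cplx R)).
Implicit Types (W : set V).

Definition linear_subset W : Prop :=
  W 0 /\ forall (c : Cplx R) u v, W u -> W v -> W (c *: u + v).

Lemma linear_subset_sum W (WL : linear_subset W) n (c : 'I_n -> Cplx R)
    (e : 'I_n -> V) : (forall i, W (e i)) -> W (\sum_(i < n) c i *: e i).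
Proof.
case: WL => W0 WP We; elim/big_ind : _ => // [u v Wu Wv|i _].
  by rewrite -[u]scale1r; exact: WP.
by rewrite -[_ *: _]addr0; exact: WP.
Qed.

Lemma span_linear_subset n (e : 'I_n -> V) : linear_subset (span e).
Proof.
split; first by exists (fun=> 0); rewrite big1// => i _; rewrite scale0r.
move=> c _ _ [a ->] [b ->]; exists (fun i => c * a i + b i).
rewrite scaler_sumr -big_split; apply: eq_bigr => i _.
by rewrite scalerDl scalerA.
Qed.

Lemma span_gen n (e : 'I_n -> V) i : span e (e i).
Proof.
exists (fun j => (j == i)%:R); rewrite (bigD1 i)//= eqxx scale1r big1 ?addr0//.
by move=> j /negbTE ->; rewrite scale0r.
Qed.

(** If [n < m], the matrix of coefficients of [f] with respect to [e] has a nonzero row in its left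
    kernel, which is a linear relation among the [f j]. *)
Lemma lin_indep_span_leq m n (f : 'I_m -> V) (e : 'I_n -> V) :
  lin_indep f -> (forall j, span e (f j)) -> (m <= n)%N.
Proof.
move=> fI /choice[M fM]; rewrite leqNgt; apply/negP => nm.
pose A := \matrix_(j < m, i < n) M j i.
have : kermx A != 0.
  rewrite -mxrank_eq0 mxrank_ker -lt0n subn_gt0.
  by rewrite (leq_ltn_trans _ nm)// rank_leq_col.
move=> /rowV0Pn[v /sub_kermxP vA /negP]; apply; apply/eqP/rowP => j.
rewrite mxE; apply: fI j; under eq_bigr do rewrite fM scaler_sumr.
rewrite exchange_big big1//= => i _.
under eq_bigr do rewrite scalerA; rewrite -scaler_suml.
suff -> : \sum_(j < m) v 0 j * M j i = (v *m A) 0 i by rewrite vA mxE scale0r.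
by rewrite mxE; apply: eq_bigr => j _; rewrite mxE.
Qed.

Variable form : {dot V for @Num.conj (Cplx R)}.
Local Notation "''[' u , v ]" := (form u%R v%R) : ring_scope.
Local Notation "''[' u ]" := '[u, u]%R : ring_scope.

Lemma dotC u v : '[u, v] = '[v, u]^*.
Proof. by rewrite hermC/= expr0 mul1r. Qed.

Lemma dotDl u v w : '[u + v, w] = '[u, w] + '[v, w].
Proof. exact: linearDl. Qed.
Lemma dotDr u v w : '[w, u + v] = '[w, u] + '[w, v].
Proof. exact: linearDr. Qed.
Lemma dotBl u v w : '[u - v, w] = '[u, w] - '[v, w].
Proof. exact: linearBl. Qed.
Lemma dotBr u v w : '[w, u - v] = '[w, u] - '[w, v].
Proof. exact: linearBr. Qed.
Lemma dotZl a u w : '[a *: u, w] = a * '[u, w].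
Proof. exact: linearZl_LR. Qed.
Lemma dotZr a u w : '[w, a *: u] = a^* * '[w, u].
Proof. exact: linearZr_LR. Qed.

Lemma dot_suml n (F : 'I_n -> V) w :
  '[\sum_(i < n) F i, w] = \sum_(i < n) '[F i, w].
Proof. exact: linear_sumlz. Qed.
Lemma dot_sumr n (F : 'I_n -> V) w :
  '[w, \sum_(i < n) F i] = \sum_(i < n) '[w, F i].
Proof. exact: linear_sumr. Qed.

Lemma dot_parallelogram u v : '[u + v] + '[u - v] = 2 * '[u] + 2 * '[v].
Proof. by rewrite !dotDl !dotDr !linearNl !linearNr; ring. Qed.

Definition orthonormal_family n (e : 'I_n -> V) : Prop :=
  forall i j, '[e i, e j] = (i == j)%:R.

Section Family.
Variables (n : nat) (e : 'I_n -> V).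
Hypothesis eON : orthonormal_family e.

Lemma dot_sum_on (c : 'I_n -> Cplx R) i : '[\sum_(j < n) c j *: e j, e i] = c i.
Proof.
rewrite dot_suml (bigD1 i)//= dotZl eON eqxx mulr1 big1 ?addr0// => j ji.
by rewrite dotZl eON (negbTE ji) mulr0.
Qed.

Lemma on_lin_indep : lin_indep e.
Proof. by move=> c ce i; rewrite -(dot_sum_on c i) ce linear0l. Qed.

Lemma on_coord v : span e v -> v = \sum_(i < n) '[v, e i] *: e i.
Proof. by move=> [c ->]; apply: eq_bigr => i _; rewrite dot_sum_on. Qed.

Lemma on_residual v i : '[v - \sum_(j < n) '[v, e j] *: e j, e i] = 0.
Proof. by rewrite dotBl dot_sum_on subrr. Qed.

Lemma on_parseval v w : span e v ->
  '[v, w] = \sum_(i < n) '[v, e i] * '[w, e i]^*.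
Proof.
move=> /on_coord {1}->; rewrite dot_suml; apply: eq_bigr => i _.
by rewrite dotZl -dotC.
Qed.

(** The projection [w] of [v] satisfies [<w, w> = <v, w>], so the squared norm of [v - w] is
    [<v, v> - <v, w>], where [<v, w>] is the sum in question. *)
Lemma bessel v : \sum_(i < n) `|'[v, e i]| ^+ 2 <= '[v].
Proof.
pose w := \sum_(i < n) '[v, e i] *: e i.
have vw : '[v, w] = \sum_(i < n) `|'[v, e i]| ^+ 2.
  by rewrite dot_sumr; apply: eq_bigr => i _; rewrite dotZr mulrC normCK.
have ww : '[w] = '[v, w].
  have /eqP : '[v - w, w] = 0.
    by rewrite dot_sumr big1// => i _; rewrite dotZr on_residual mulr0.
  by rewrite dotBl subr_eq0 => /eqP.
have := dnorm_ge0 form (v - w); rewrite dotBl !dotBr -vw.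
have -> : '[w, v] = '[w] by rewrite dotC -ww -dotC.
by rewrite subrr subr0 subr_ge0.
Qed.

End Family.

(** The new vector enters at index [ord0], as an explicit multiple of [v], so that it visibly stays
    in any subspace containing [v]. *)
Lemma on_extend n (e : 'I_n -> V) (v : V) : orthonormal_family e -> v != 0 ->
  (forall i, '[v, e i] = 0) ->
  exists2 c : Cplx R, c != 0 & orthonormal_family
    (fun i : 'I_n.+1 => if unlift ord0 i is Some j then e j else c *: v).
Proof.
move=> eON v0 ve; have vv : 0 < '[v] by rewrite dnorm_gt0.
exists (sqrtC '[v])^-1; first by rewrite invr_eq0 sqrtC_eq0 dnorm_eq0.
move=> i j; case: unliftP => [i' ->|->]; case: unliftP => [j' ->|->].
- by rewrite eON (inj_eq lift_inj).
- by rewrite dotZr (dotC (e _)) ve conjC0 mulr0 eq_sym (negbTE (neq_lift _ _)).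
- by rewrite dotZl ve mulr0 (negbTE (neq_lift _ _)).
rewrite eqxx dnormZ normfV exprVn ger0_norm ?sqrtC_ge0 ?ltW//.
by rewrite sqrtCK mulVf ?gt_eqF.
Qed.

(** A maximal orthonormal family in [W] spans [W]: the residual of a vector outside its span would
    normalize to a further member. *)
Lemma on_basis W N : linear_subset W ->
  (forall n (e : 'I_n -> V), orthonormal_family e -> (forall i, W (e i)) ->
    (n <= N)%N) ->
  exists n (e : 'I_n -> V), [/\ (n <= N)%N, orthonormal_family e & W = span e].
Proof.
move=> WL bnd.
pose P := [pred n | `[< exists2 e : 'I_n -> V, orthonormal_family e &
  forall i, W (e i) >]].
have Pb n : P n -> (n <= N)%N by move=> /asboolP[e eON eW]; exact: bnd eON eW.
have P0 : exists n, P n.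
  by exists 0; apply/asboolP; exists (fun=> 0) => [|] []//.
case: (ex_maxnP P0 Pb) => n /[dup] /Pb nN /asboolP[e eON eW] nmax.
exists n, e; split=> //; apply/seteqP; split=> [v Wv|_ [c ->]]; last first.
  exact: linear_subset_sum.
apply: contrapT => ve; pose w := v - \sum_(j < n) '[v, e j] *: e j.
have Ww : W w.
  rewrite /w -scaleN1r addrC; apply: (WL.2) => //; exact: linear_subset_sum.
have w0 : w != 0.
  apply/eqP => w0; apply: ve; exists (fun j => '[v, e j]); exact/subr0_eq.
have [c _ eON'] := on_extend eON w0 (on_residual eON v).
suff /nmax : P n.+1 by rewrite ltnn.
apply/asboolP; eexists; first exact: eON'.
move=> i /=; case: unliftP => [j _|_]; first exact: eW.
by rewrite -[_ *: _]addr0; apply: (WL.2) => //; exact: WL.1.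
Qed.

Lemma on_basis_span W n (e : 'I_n -> V) : linear_subset W -> W `<=` span e ->
  exists m (f : 'I_m -> V),
    [/\ (m <= n)%N, orthonormal_family f & W = span f].
Proof.
move=> WL We; apply: on_basis => // m f fON fW.
by apply: (lin_indep_span_leq (on_lin_indep fON)) => j; exact/We/fW.
Qed.

(** Adjoining to a basis of [W] the residual of a vector of [span e] outside [W] gives [m + 1]
    independent vectors of [span e]. The strict drop drives the induction in
    [intertwiner_stable]. *)
Lemma on_basis_proper W n (e : 'I_n -> V) : linear_subset W ->
  W `<=` span e -> W <> span e ->
  exists m (f : 'I_m -> V),
    [/\ (m < n)%N, orthonormal_family f & W = span f].
Proof.
move=> WL We Wne; have [m [f [mn fON Wf]]] := on_basis_span WL We.
exists m, f; split=> //; have [v ev Wv] : exists2 v, span e v & ~ W v.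
  apply: contrapT => H; apply: Wne; apply/seteqP; split=> // v ev.
  by apply: contrapT => Wv; apply: H; exists v.
pose w := v - \sum_(j < m) '[v, f j] *: f j.
have w0 : w != 0.
  apply/eqP => w0; apply: Wv; rewrite Wf; exists (fun j => '[v, f j]).
  exact/subr0_eq.
have [c c0 fON'] := on_extend fON w0 (on_residual fON v).
apply: (lin_indep_span_leq (on_lin_indep fON')) => i.
have fe j : span e (f j) by apply/We; rewrite Wf; exact: span_gen.
case: unliftP => [j _|_]; first exact: fe.
rewrite -[_ *: _]addr0; apply: (span_linear_subset e).2; last first.
  exact: (span_linear_subset e).1.
rewrite /w -scaleN1r addrC; apply: (span_linear_subset e).2 => //.
exact: (linear_subset_sum (span_linear_subset e)).
Qed.

(** Bessel's inequality for the single vector [v / |v|]. *)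
Lemma dot_cauchy_schwarz u v : `|'[u, v]| ^+ 2 <= '[u] * '[v].
Proof.
have [->|v0] := eqVneq v 0; first by rewrite !linear0r normr0 expr0n ?mulr0.
have vv : 0 < '[v] by rewrite dnorm_gt0.
pose e (i : 'I_1) := (sqrtC '[v])^-1 *: v.
have eON : orthonormal_family e.
  move=> i j; rewrite !ord1 eqxx dnormZ normfV exprVn ger0_norm.
    by rewrite sqrtCK mulVf ?gt_eqF.
  by rewrite sqrtC_ge0 ltW.
have := bessel eON u; rewrite big_ord1 dotZr normrM exprMn.
rewrite norm_conjC normfV exprVn (ger0_norm (x := sqrtC _)) ?sqrtC_ge0 ?(ltW vv)//.
rewrite sqrtCK.
by rewrite mulrC ler_pdivrMr.
Qed.

End Orthonormal.

(** * Integration of complex functions *)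

Section ComplexNumbers.
Variable R : realType.
Implicit Types x y : Cplx R.

Lemma cReM x y : complex.Re (x * y) =
  complex.Re x * complex.Re y - complex.Im x * complex.Im y.
Proof. by case: x; case: y. Qed.

Lemma cImM x y : complex.Im (x * y) =
  complex.Re x * complex.Im y + complex.Im x * complex.Re y.
Proof. by case: x => a b; case: y => c d /=; rewrite addrC. Qed.

Lemma cReJ x : complex.Re x^* = complex.Re x.
Proof. by case: x. Qed.

Lemma cImJ x : complex.Im x^* = - complex.Im x.
Proof. by case: x. Qed.

Lemma cReD x y : complex.Re (x + y) = complex.Re x + complex.Re y.
Proof. by case: x; case: y. Qed.

Lemma cImD x y : complex.Im (x + y) = complex.Im x + complex.Im y.
Proof. by case: x; case: y. Qed.

Lemma cReB x y : complex.Re (x - y) = complex.Re x - complex.Re y.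
Proof. by case: x; case: y. Qed.

Lemma cImB x y : complex.Im (x - y) = complex.Im x - complex.Im y.
Proof. by case: x; case: y. Qed.

Lemma Cplx_eq x y : complex.Re x = complex.Re y -> complex.Im x = complex.Im y ->
  x = y.
Proof. by case: x => a b; case: y => c d /= -> ->. Qed.

Definition toC (r : R) : Cplx R := Complex r 0.

Lemma toC_le (a b : R) : (toC a <= toC b) = (a <= b).
Proof. exact: lecR. Qed.

Lemma toC_lt (a b : R) : (toC a < toC b) = (a < b).
Proof. exact: ltcR. Qed.

Lemma toCD a b : toC (a + b) = toC a + toC b.
Proof. by apply: Cplx_eq; rewrite /= ?addr0. Qed.

Lemma toCB a b : toC (a - b) = toC a - toC b.
Proof. by apply: Cplx_eq; rewrite /= ?subr0. Qed.

Lemma toCM a b : toC (a * b) = toC a * toC b.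
Proof. by apply: Cplx_eq => /=; ring. Qed.

Lemma toCX a n : toC (a ^+ n) = toC a ^+ n.
Proof. by elim: n => // n IH; rewrite !exprS toCM IH. Qed.

Lemma toCJ a : (toC a)^* = toC a.
Proof. by apply: Cplx_eq; rewrite /= ?oppr0. Qed.

Lemma toC_inj : injective toC.
Proof. by move=> x y []. Qed.

Lemma toC_nat n : toC n%:R = n%:R.
Proof. by elim: n => // n IH; rewrite -!natr1 toCD IH. Qed.

Lemma toC_ge0 a : (0 <= toC a) = (0 <= a).
Proof. exact: toC_le. Qed.

Lemma toC_norm a : `|toC a| = toC `|a|.
Proof.
have [a0|a0] := leP 0 a; first by rewrite ger0_norm ?toC_ge0// ger0_norm.
rewrite ler0_norm ?ltr0_norm//; last by have := toC_le a 0; rewrite (ltW a0).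
by apply: Cplx_eq; rewrite /= ?oppr0.
Qed.

Lemma toC_Re x : 0 <= x -> toC (complex.Re x) = x.
Proof. by move=> x0; apply: Cplx_eq; rewrite //= ger0_Im. Qed.

(** The norm on [Cplx R] takes its values in [Cplx R]; a real-valued modulus can enter suprema and
    real integrals. *)
Definition nrm x : R := complex.Re `|x|.

Lemma nrmE x : toC (nrm x) = `|x|.
Proof. by rewrite toC_Re ?normr_ge0. Qed.

Lemma nrm_ge0 x : 0 <= nrm x.
Proof. by rewrite -toC_ge0 nrmE normr_ge0. Qed.

Lemma nrm_le x (r : R) : (nrm x <= r) = (`|x| <= toC r).
Proof. by rewrite -toC_le nrmE. Qed.

Lemma nrm_lt x (r : R) : (nrm x < r) = (`|x| < toC r).
Proof. by rewrite -toC_lt nrmE. Qed.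

Lemma nrmM x y : nrm (x * y) = nrm x * nrm y.
Proof. by rewrite /nrm normrM -!nrmE -toCM. Qed.

Lemma nrmD x y : nrm (x + y) <= nrm x + nrm y.
Proof. by rewrite nrm_le toCD !nrmE ler_normD. Qed.

Lemma nrmB x y : nrm (x - y) = nrm (y - x).
Proof. by rewrite /nrm distrC. Qed.

Lemma nrmJ x : nrm x^* = nrm x.
Proof. by rewrite /nrm norm_conjC. Qed.

Lemma nrm_toC a : nrm (toC a) = `|a|.
Proof. by rewrite /nrm toC_norm. Qed.

Lemma nrm0P x : nrm x = 0 -> x = 0.
Proof. by move=> x0; apply/normr0_eq0; rewrite -nrmE x0. Qed.

Lemma Re_le_nrm x : `|complex.Re x| <= nrm x.
Proof. by rewrite -toC_le nrmE; exact: normc_ge_Re. Qed.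

(** Multiplication by ['i] keeps the modulus and turns the imaginary part, up to sign, into the real
    part. *)
Lemma Im_le_nrm x : `|complex.Im x| <= nrm x.
Proof.
have := Re_le_nrm ('i * x); rewrite nrmM {1}/nrm normCi mul1r cReM.
have -> : 'i = Complex 0 1 :> Cplx R by rewrite -complexiE.
by rewrite /= mul0r add0r mul1r normrN.
Qed.

Lemma nrm_sq x : nrm x ^+ 2 = complex.Re x ^+ 2 + complex.Im x ^+ 2.
Proof.
suff : toC (nrm x ^+ 2) = toC (complex.Re x ^+ 2 + complex.Im x ^+ 2) by case.
by rewrite toCX nrmE; exact/esym/add_Re2_Im2.
Qed.

Lemma nrm_le_ReIm x : nrm x <= `|complex.Re x| + `|complex.Im x|.
Proof.
rewrite -(ler_pXn2r (n := 2)) ?nnegrE ?addr_ge0 ?nrm_ge0// nrm_sq sqrrD.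
by rewrite !real_normK ?num_real// addrAC lerDl mulrn_wge0// mulr_ge0.
Qed.

Lemma lt_toC x : 0 < x -> exists2 r : R, 0 < r & x = toC r.
Proof.
by move=> x0; exists (complex.Re x); rewrite -?toC_lt toC_Re ?ltW.
Qed.

Variable T : topologicalType.

Lemma continuous_Re (f : T -> Cplx R) : continuous f ->
  continuous (fun t => complex.Re (f t)).
Proof.
move=> fc t; apply/cvgrPdist_lt => e e0.
have /cvgrPdist_lt/(_ (toC e)) := fc t; rewrite toC_lt => /(_ e0).
apply: filterS => s; rewrite -nrm_lt; apply: le_lt_trans.
by rewrite -cReB Re_le_nrm.
Qed.

Lemma continuous_Im (f : T -> Cplx R) : continuous f ->
  continuous (fun t => complex.Im (f t)).
Proof.
move=> fc t; apply/cvgrPdist_lt => e e0.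
have /cvgrPdist_lt/(_ (toC e)) := fc t; rewrite toC_lt => /(_ e0).
apply: filterS => s; rewrite -nrm_lt; apply: le_lt_trans.
by rewrite -cImB Im_le_nrm.
Qed.

Lemma continuous_toC (f : T -> R) : continuous f ->
  continuous (fun t => toC (f t)).
Proof.
move=> fc t; apply/cvgrPdist_lt => _ /lt_toC[e e0 ->].
have /cvgrPdist_lt/(_ e e0) := fc t.
by apply: filterS => s; rewrite -toCB toC_norm toC_lt.
Qed.

Lemma continuous_nrm (f : T -> Cplx R) : continuous f ->
  continuous (fun t => nrm (f t)).
Proof.
move=> fc; apply: continuous_Re => t.
by apply: cvg_norm; exact: fc.
Qed.

Lemma continuous_conj (f : T -> Cplx R) : continuous f ->
  continuous (fun t => (f t)^*).
Proof.
move=> fc t; apply/cvgrPdist_lt => e e0.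
have /cvgrPdist_lt/(_ e e0) := fc t.
by apply: filterS => s; rewrite -rmorphB norm_conjC.
Qed.

Lemma compact_bounded_cts (f : T -> Cplx R) : compact [set: T] -> continuous f ->
  exists2 M : R, 0 <= M & forall t, nrm (f t) <= M.
Proof.
move=> cT fc.
have /compact_bounded : compact ((fun t => nrm (f t)) @` [set: T] : set R^o).
  apply: continuous_compact => //; apply: continuous_subspaceT => t.
  exact: continuous_nrm.
move=> [M [_ /(_ (`|M| + 1))]]; rewrite (le_lt_trans (ler_norm M)) ?ltrDl//.
move=> /(_ isT) H; exists (`|M| + 1) => [|t]; first by rewrite addr_ge0.
by apply: le_trans (H (nrm (f t)) _); [exact: ler_norm|exists t].
Qed.

End ComplexNumbers.

Section ComplexIntegral.
Context d (T : measurableType d) (R : realType).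
Variable mu : probability T R.
Implicit Types f g : T -> Cplx R.

Definition Cintegral f : Cplx R :=
  Complex (\int[mu]_x complex.Re (f x))%R (\int[mu]_x complex.Im (f x))%R.

Definition Cintegrable f : Prop :=
  mu.-integrable setT (EFin \o (fun x => complex.Re (f x))) /\
  mu.-integrable setT (EFin \o (fun x => complex.Im (f x))).

Lemma integrable_lin (a b : R) (f g : T -> R) :
  mu.-integrable setT (EFin \o f) -> mu.-integrable setT (EFin \o g) ->
  mu.-integrable setT (EFin \o (fun x => a * f x + b * g x)).
Proof.
move=> fI gI.
have -> : EFin \o (fun x => a * f x + b * g x) =
    ((fun x => a%:E * (f x)%:E) \+ (fun x => b%:E * (g x)%:E))%E.
  by apply/funext => x /=; rewrite EFinD !EFinM.
by apply: integrableD => //; exact: integrableZl.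
Qed.

Lemma Rintegral_lin (a b : R) (f g : T -> R) :
  mu.-integrable setT (EFin \o f) -> mu.-integrable setT (EFin \o g) ->
  \int[mu]_x (a * f x + b * g x) = a * \int[mu]_x f x + b * \int[mu]_x g x.
Proof.
move=> fI gI; rewrite RintegralD//; first by rewrite !RintegralZl.
- have := integrable_lin a 0 fI gI; congr (integrable _ _ _).
  by apply/funext => x /=; rewrite mul0r addr0.
- have := integrable_lin 0 b fI gI; congr (integrable _ _ _).
  by apply/funext => x /=; rewrite mul0r add0r.
Qed.

Lemma CintegrableP (c : Cplx R) f g : Cintegrable f -> Cintegrable g ->
  Cintegrable (fun x => c * f x + g x).
Proof.
move=> [fr fi] [gr gi]; split.
  have := integrable_lin 1 1
    (integrable_lin (complex.Re c) (- complex.Im c) fr fi) gr.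
  congr (integrable _ _ _); apply/funext => x.
  by rewrite /comp cReD cReM !mul1r mulNr.
have := integrable_lin 1 1
  (integrable_lin (complex.Re c) (complex.Im c) fi fr) gi.
congr (integrable _ _ _); apply/funext => x.
by rewrite /comp cImD cImM !mul1r.
Qed.

Lemma CintegralP (c : Cplx R) f g : Cintegrable f -> Cintegrable g ->
  Cintegral (fun x => c * f x + g x) = c * Cintegral f + Cintegral g.
Proof.
move=> [fr fi] [gr gi]; apply: Cplx_eq.
  rewrite [RHS]cReD cReM/= -mulNr -Rintegral_lin// -[X in _ = _ + X]mul1r.
  rewrite -[X in _ = X + _]mul1r -Rintegral_lin//; last exact: integrable_lin.
  by congr Rintegral; apply/funext => x; rewrite cReD cReM !mul1r mulNr.
rewrite [RHS]cImD cImM/= -Rintegral_lin// -[X in _ = _ + X]mul1r.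
rewrite -[X in _ = X + _]mul1r -Rintegral_lin//; last exact: integrable_lin.
by congr Rintegral; apply/funext => x; rewrite cImD cImM !mul1r.
Qed.

Lemma Cintegrable0 : Cintegrable (fun=> 0).
Proof. by split; exact: integrable0. Qed.

Lemma Cintegral0 : Cintegral (fun=> 0) = 0.
Proof. by apply: Cplx_eq; rewrite /= Rintegral_cst// mul0r. Qed.

Lemma CintegrableZ (c : Cplx R) f : Cintegrable f ->
  Cintegrable (fun x => c * f x).
Proof.
move=> fI; have := CintegrableP c fI Cintegrable0.
by congr Cintegrable; apply/funext => x; rewrite addr0.
Qed.

Lemma CintegralZ (c : Cplx R) f : Cintegrable f ->
  Cintegral (fun x => c * f x) = c * Cintegral f.
Proof.
move=> fI; rewrite -[RHS]addr0 -Cintegral0 -(CintegralP _ fI Cintegrable0).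
by congr Cintegral; apply/funext => x; rewrite addr0.
Qed.

Lemma Cintegral_conj f : Cintegrable f ->
  Cintegral (fun x => (f x)^*) = (Cintegral f)^*.
Proof.
move=> [fr fi]; apply: Cplx_eq.
  by rewrite [RHS]cReJ; congr Rintegral; apply/funext => x; rewrite cReJ.
rewrite [RHS]cImJ -mulN1r -RintegralZl//.
by congr Rintegral; apply/funext => x; rewrite cImJ mulN1r.
Qed.

Lemma Cintegral_norm_le f (r : T -> R) : Cintegrable f ->
  mu.-integrable setT (EFin \o r) -> (forall x, nrm (f x) <= r x) ->
  nrm (Cintegral f) <= \int[mu]_x r x.
Proof.
(* Rotate by the conjugate phase of the integral and take real parts. *)
move=> fI rI fr; set c := Cintegral f.
have [c0|c0] := eqVneq c 0.
  rewrite c0 -[0]/(toC 0) nrm_toC normr0 Rintegral_ge0// => x _.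
  exact: le_trans (nrm_ge0 _) (fr x).
have c1 : 0 < nrm c.
  by rewrite lt_neqAle nrm_ge0 andbT eq_sym; apply: contra_neq c0 => /nrm0P.
rewrite -(ler_pM2l c1) -expr2.
have -> : nrm c ^+ 2 = complex.Re (Cintegral (fun x => c^* * f x)).
  by rewrite CintegralZ// -/c nrm_sq cReM cReJ cImJ; ring.
rewrite -RintegralZl//; apply: le_Rintegral => //; first exact: (CintegrableZ _ fI).1.
  have := integrable_lin (nrm c) 0 rI rI; congr (integrable _ _ _).
  by apply/funext => x /=; rewrite mul0r addr0.
move=> x _; apply: le_trans (ler_norm _) _.
apply: le_trans (Re_le_nrm _) _; rewrite nrmM nrmJ.
by rewrite ler_wpM2l ?nrm_ge0.
Qed.

End ComplexIntegral.

Section BorelIntegral.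
Variables (R : realType) (K : ptopologicalType) (mu : probability (borel K) R).
Implicit Types f g h : borel K -> Cplx R.

Lemma continuous_measurable_borel (f : K -> R) : continuous f ->
  measurable_fun [set: borel K] (f : borel K -> R).
Proof.
move=> /continuousP fc.
apply: (measurability _ (RGenOInfty.measurableE R)).
move=> /= _ [_ [r ->] <-]; apply: measurableI => //.
by apply: sub_sigma_algebra; exact/fc/interval_open.
Qed.

(** Through the inclusion of L-infinity in L2, valid since [mu] is finite. *)
Lemma bounded_Lfun2 (f : borel K -> R) (M : R) : measurable_fun setT f ->
  (forall x, `|f x| <= M) -> f \in Lfun mu 2%:E.
Proof.
move=> fm fM.
have muT : mu [set: borel K] \is a fin_num by rewrite probability_setT.
apply: (@Lfun_subset _ _ _ mu 2%:E +oo%E _ _ muT) => //.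
- by rewrite lee_fin ler1n.
- by rewrite leey.
- by rewrite leey.
rewrite inE; apply/andP; split; rewrite inE//=.
have mu0 : (0 < mu [set: borel K])%E by rewrite probability_setT lte01.
rewrite /finite_norm unlock /Lnorm ifT//.
by apply: le_lt_trans (ltry M); apply: ess_sup_ler => x; rewrite lee_fin.
Qed.

Lemma continuous_Lfun2 (f : K -> R) : compact [set: K] -> continuous f ->
  (f : borel K -> R) \in Lfun mu 2%:E.
Proof.
move=> cK fc; have [M _ fM] := compact_bounded_cts cK (continuous_toC fc).
apply: (@bounded_Lfun2 _ M); first exact: continuous_measurable_borel.
by move=> x; rewrite -nrm_toC.
Qed.

Lemma continuous_integrable (f : K -> R) : compact [set: K] -> continuous f ->
  mu.-integrable setT (EFin \o (f : borel K -> R)).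
Proof.
move=> cK fc; apply/Lfun1_integrable.
have muT : mu [set: borel K] \is a fin_num by rewrite probability_setT.
by apply: (Lfun_subset12 muT); exact: continuous_Lfun2.
Qed.

Lemma continuous_L2fun (f : K -> Cplx R) : compact [set: K] -> continuous f ->
  L2fun mu f.
Proof.
move=> cK fc; split; apply: continuous_Lfun2 => //.
- exact: continuous_Re.
- exact: continuous_Im.
Qed.

Lemma Lfun2_mul_integrable (f g : borel K -> R) :
  f \in Lfun mu 2%:E -> g \in Lfun mu 2%:E ->
  mu.-integrable setT (EFin \o (fun x => f x * g x)).
Proof. by move=> f2 g2; apply/Lfun1_integrable/Lfun2_mul_Lfun1. Qed.

Lemma L2fun_mul f g : L2fun mu f -> L2fun mu g ->
  Cintegrable mu (fun x => f x * (g x)^*).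
Proof.
move=> [fr fi] [gr gi]; split.
  have := integrable_lin 1 1 (Lfun2_mul_integrable fr gr)
    (Lfun2_mul_integrable fi gi).
  congr (integrable _ _ _); apply/funext => x.
  by rewrite /comp cReM cReJ cImJ !mul1r mulrN opprK.
have := integrable_lin (-1) 1 (Lfun2_mul_integrable fr gi)
  (Lfun2_mul_integrable fi gr).
congr (integrable _ _ _); apply/funext => x.
by rewrite /comp cImM cReJ cImJ mul1r mulN1r mulrN.
Qed.

Lemma L2innerPl (c : Cplx R) f g h : L2fun mu f -> L2fun mu g -> L2fun mu h ->
  L2inner mu (fun x => c * f x + g x) h = c * L2inner mu f h + L2inner mu g h.
Proof.
move=> f2 g2 h2.
rewrite -[X in _ = X](CintegralP c (L2fun_mul f2 h2) (L2fun_mul g2 h2)).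
by congr Cintegral; apply/funext => x; rewrite mulrDl mulrA.
Qed.

Lemma L2innerC f g : L2fun mu f -> L2fun mu g ->
  L2inner mu f g = (L2inner mu g f)^*.
Proof.
move=> f2 g2; rewrite -[X in _ = X](Cintegral_conj (L2fun_mul g2 f2)).
by congr Cintegral; apply/funext => x; rewrite rmorphM/= conjCK mulrC.
Qed.

Lemma L2inner_real f g (r : borel K -> R) :
  (forall x, f x * (g x)^* = toC (r x)) -> L2inner mu f g = toC (\int[mu]_x r x).
Proof.
move=> fgr; apply: Cplx_eq => /=.
  by congr Rintegral; apply/funext => x; rewrite fgr.
rewrite (_ : (fun x => _) = cst 0) ?Rintegral_cst ?mul0r//.
by apply/funext => x; rewrite fgr.
Qed.

End BorelIntegral.

(** * Translations and the invariant measure *)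

Section Action.
Variables (G : topologicalGroupType) (K : topologicalType).
Variable a : transitive_action G K.

Lemma actK g : cancel (a g) (a (g^-1)%g).
Proof. by move=> x; rewrite -actM mulVg act1. Qed.

Lemma actVK g : cancel (a (g^-1)%g) (a g).
Proof. by move=> x; rewrite -actM mulgV act1. Qed.

Lemma image_act g (A : set K) : a g @` A = a (g^-1)%g @^-1` A.
Proof.
apply/seteqP; split=> [_ [x Ax <-]|x /= Ax]; first by rewrite /= actK.
by exists (a (g^-1)%g x) => //; rewrite actVK.
Qed.

End Action.

Section InvariantMeasure.
Variables (R : realType) (G : topologicalGroupType) (K : ptopologicalType).
Variables (a : transitive_action G K) (mu : probability (borel K) R).
Hypotheses (compactK : compact [set: K]) (invmu : invariant_measure a mu).

Lemma open_measurable_borel (U : set K) : open U -> measurable (U : set (borel K)).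
Proof. exact: sub_sigma_algebra. Qed.

(** By transitivity the translates of [U] cover [K], and finitely many suffice. They all have the
    measure of [U], so [mu U = 0] would give [mu K = 0]. *)
Lemma open_measure_gt0 (U : set K) x : open U -> U x -> (0 < mu U)%E.
Proof.
move=> oU Ux; rewrite lt_neqAle measure_ge0 andbT; apply/eqP => mU.
have oV g : open (a g @` U).
  by rewrite image_act; move/continuousP: (@act_cts _ _ a (g^-1)%g); exact.
have mV g : measurable (a g @` U : set (borel K)) by exact: open_measurable_borel.
have := compactK; rewrite compact_cover => /(_ G setT (fun g => a g @` U)).
case=> // [y _|D _ Dcov].
  by have [g gx] := act_transitive a x y; exists g => //; exists x.
have := @content_sub_fsum _ _ _ mu G [set` D] setT (fun g => a g @` U).
move=> /(_ (finite_fset D) (fun g _ => mV g) measurableT Dcov).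
rewrite [X in (X <= _)%E](probability_setT mu) fsbig1 ?lee_fin ?ler10// => g _.
exact: etrans (invmu g (open_measurable_borel oU)) (esym mU).
Qed.

Lemma measurable_act g : measurable_fun setT (a g : borel K -> borel K).
Proof.
refine (@measurability _ _ (borel K) (borel K) setT (a g) (@open K) erefl _).
move=> _ [U oU <-].
apply: measurableI => //; apply: open_measurable_borel.
by move/continuousP: (@act_cts _ _ a g); exact.
Qed.

(** Change of variables: the image measure of [mu] under [a g] is [mu], since preimages under [a g]
    are images under the inverse of [g]. *)
Lemma Rintegral_act g (f : K -> R) : continuous f ->
  \int[mu]_x f (a g x) = \int[mu]_x f x.
Proof.
move=> fc.
have fm : measurable_fun setT (EFin \o (f : borel K -> R)).
  by apply/measurable_EFinP; exact: continuous_measurable_borel.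
have fgI : mu.-integrable (a g @^-1` setT) ((EFin \o (f : borel K -> R)) \o a g).
  rewrite preimage_setT; apply: (@continuous_integrable _ _ mu (f \o a g)) => // x.
  by apply: continuous_comp; [exact: act_cts | exact: fc].
have := integral_pushforward (measurable_act g) fm fgI measurableT.
rewrite preimage_setT /Rintegral => <-; congr fine.
apply: eq_measure_integral => [|mphi A mA _]; first exact: measurable_act.
by have := @invmu (g^-1)%g A mA; rewrite image_act invgK.
Qed.

Lemma L2inner_translate g (f h : Cfun R K) :
  L2inner mu (translate a g f) (translate a g h) = L2inner mu f h.
Proof.
have fhc : continuous (fun x => f x * (h x)^*).
  move=> x; apply: cvgM; first exact: cts_fun.
  by apply: continuous_conj; exact: cts_fun.
apply: Cplx_eq.
  exact: (Rintegral_act _ (continuous_Re fhc)).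
exact: (Rintegral_act _ (continuous_Im fhc)).
Qed.

Lemma Cfun_L2 (f : Cfun R K) : L2fun mu f.
Proof. by apply: continuous_L2fun => //; exact: cts_fun. Qed.

(** If [f x != 0], the squared modulus of [f] exceeds half its value at [x] on an open neighbourhood
    [U] of [x], and [U] has positive measure. *)
Lemma L2inner_gt0 (f : Cfun R K) : f != 0 -> 0 < L2inner mu f f.
Proof.
move=> f0.
have fc : continuous (fun y => nrm (f y) ^+ 2).
  have nc := continuous_nrm (@cts_fun _ _ f).
  by move=> y; apply: (cvgM (nc y) (nc y)).
have [x fx] : exists x, f x != 0.
  apply: contrapT => H; move/eqP: f0; apply; apply/continuousEP => x.
  by apply/eqP; apply: contrapT => fx; apply: H; exists x; apply/negP.
pose e := nrm (f x) ^+ 2 / 2.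
have e0 : 0 < e.
  rewrite divr_gt0// exprn_gt0// lt_neqAle nrm_ge0 andbT eq_sym.
  by apply: contra_neq fx => /nrm0P.
pose U := [set y | e < nrm (f y) ^+ 2].
have oU : open U.
  rewrite (_ : U = (fun y => nrm (f y) ^+ 2) @^-1` `]e, +oo[%classic).
    by move/continuousP: fc; apply; exact: interval_open.
  by apply/seteqP; split=> y; rewrite /U /= in_itv/= andbT.
have Ux : U x by rewrite /U /= /e ltr_pdivrMr// ltr_pMr ?ltr1n//
  -(@ltr_pM2r _ 2^-1) ?invr_gt0// mul0r.
have mU := open_measurable_borel oU.
have muU := open_measure_gt0 oU Ux.
rewrite (@L2inner_real _ _ _ _ _ (fun y => nrm (f y) ^+ 2)); last first.
  by move=> y; rewrite toCX nrmE normCK.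
rewrite toC_lt.
have fI : mu.-integrable setT (EFin \o (fun y : borel K => nrm (f y) ^+ 2)).
  exact: continuous_integrable.
have fm := continuous_measurable_borel fc.
rewrite -lte_fin /Rintegral fineK; last exact: integrable_fin_num.
apply: (@lt_le_trans _ _ (\int[mu]_(y in U) e%:E)%E).
  by rewrite integral_cst// mule_gt0.
apply: (@le_trans _ _ (\int[mu]_(y in U) (nrm (f y) ^+ 2)%:E)%E).
  apply: ge0_le_integral => //.
  - by move=> y _; rewrite lee_fin ltW.
  - by apply/measurable_EFinP; exact: measurable_funTS fm.
  - by move=> y Uy; rewrite lee_fin ltW.
apply: ge0_subset_integral => //.
  by apply/measurable_EFinP; exact: fm.
by move=> y _; rewrite lee_fin sqr_ge0.
Qed.

Lemma L2inner_dot_bilinear :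
  bilinear_for (GRing.Scale.Law.clone _ _ *%R _)
    (GRing.Scale.Law.clone _ _ (@Num.conj (Cplx R) \; *%R) _)
    (fun f h : Cfun R K => L2inner mu f h).
Proof.
have L2 := Cfun_L2.
split=> [h|h] c f f' /=; first exact: L2innerPl.
rewrite L2innerC// (L2innerC (L2 _) (L2 f)) (L2innerC (L2 _) (L2 f')).
by rewrite -rmorphM -rmorphD; congr (_^*); exact: L2innerPl.
Qed.

Lemma L2inner_hermitian (f h : Cfun R K) :
  L2inner mu f h = (-1) ^+ false * (L2inner mu h f)^*.
Proof. by rewrite expr0 mul1r; apply: L2innerC; exact: Cfun_L2. Qed.

(** Packing [L2inner] as a dot product opens it to the lemmas on orthonormal families; it is
    definite because [mu] has full support. *)
Definition L2dot : {dot Cfun R K for @Num.conj (Cplx R)} :=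
  let F := fun f h : Cfun R K => L2inner mu f h in
  HB.pack F
    (bilinear_isBilinear.Build _ _ _ _ _ _ F L2inner_dot_bilinear)
    (isHermitianSesquilinear.Build _ _ _ _ F L2inner_hermitian)
    (isDotProduct.Build _ _ F L2inner_gt0).

End InvariantMeasure.

Arguments L2dot : simpl never.

(** A tube argument: near [x] and [t0], both [F (t, y)] and [F (t0, y)] stay within [e / 2] of
    [F (t0, x)], and compactness of [X] makes the neighbourhood of [t0] uniform in [x]. *)
Lemma compact_uniform_near (R : realType) (T X : topologicalType)
    (F : T * X -> Cplx R) (t0 : T) (e : R) :
  compact [set: X] -> continuous F -> 0 < e ->
  \forall t \near t0, forall x, nrm (F (t, x) - F (t0, x)) < e.
Proof.
move=> /compact_near_coveringP cX Fc e0.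
suff : \forall t \near t0, [set: X] `<=` (fun x => nrm (F (t, x) - F (t0, x)) < e).
  by apply: filterS => t H x; exact: H.
apply: cX => x _.
have e2 : 0 < toC (e / 2) by rewrite (toC_lt 0) divr_gt0.
have /cvgrPdist_lt/(_ _ e2)[[U V] /= [Ut Vx] UV] := Fc (t0, x).
exists (V, U) => //= -[y t] /= [Vy Ut'].
have := UV (t, y) (conj Ut' Vy); rewrite /= -nrm_lt => h1.
have := UV (t0, y) (conj (nbhs_singleton Ut) Vy); rewrite /= -nrm_lt => h2.
rewrite -(subrK (F (t0, x)) (F (t, y))) -addrA (splitr e).
by apply: le_lt_trans (nrmD _ _) _; rewrite ltrD// nrmB.
Qed.

Section CfunTheory.
Variables (R : realType) (G : topologicalGroupType) (K : topologicalType).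
Variable a : transitive_action G K.
Implicit Types (f h : Cfun R K) (g : G).

Lemma CfunP f h : f =1 h -> f = h.
Proof. by move=> fh; apply/continuousEP. Qed.

Lemma CfunE c f h x : (c *: f + h) x = c * f x + h x.
Proof. by []. Qed.

Lemma CfunDE f h x : (f + h) x = f x + h x.
Proof. by []. Qed.

Lemma CfunZE c f x : (c *: f) x = c * f x.
Proof. by []. Qed.

Lemma CfunBE f h x : (f - h) x = f x - h x.
Proof. by []. Qed.

Lemma Cfun_sumE n (F : 'I_n -> Cfun R K) x :
  (\sum_(i < n) F i) x = \sum_(i < n) F i x.
Proof.
by elim/big_rec2 : _ => // i y1 y2 _ <-; rewrite CfunDE.
Qed.

Lemma translateE g f x : translate a g f x = f (a (g^-1)%g x).
Proof. by []. Qed.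

Lemma translate1 f : translate a 1%g f = f.
Proof.
apply: CfunP => x.
rewrite translateE.
rewrite invg1.
by rewrite (act1 a).
Qed.

Lemma translateM g k f : translate a (g * k)%g f = translate a g (translate a k f).
Proof.
apply: CfunP => x.
rewrite !translateE.
rewrite invgM.
by rewrite (actM a).
Qed.

Lemma translateP g c f h :
  translate a g (c *: f + h) = c *: translate a g f + translate a g h.
Proof. exact: CfunP. Qed.

Lemma Cfun_bounded f : compact [set: K] ->
  exists2 M : R, 0 <= M & forall x, nrm (f x) <= M.
Proof. by move=> cK; apply: compact_bounded_cts cK _; exact: cts_fun. Qed.

Lemma Cfun_bounded_family n (F : 'I_n -> Cfun R K) : compact [set: K] ->
  exists2 M : R, 0 <= M & forall i x, nrm (F i x) <= M.
Proof.
move=> cK; have /choice[M HM] : forall i, exists M : R,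
    0 <= M /\ forall x, nrm (F i x) <= M.
  by move=> i; have [M M0 FM] := Cfun_bounded (F i) cK; exists M.
exists (\sum_(i < n) M i); first by rewrite sumr_ge0// => i _; case: (HM i).
move=> i x; rewrite (bigD1 i)//=; have [_ FM] := HM i.
apply: le_trans (FM x) _; rewrite lerDl sumr_ge0// => j _; by case: (HM j).
Qed.

Lemma translate_near f (g0 : G) (e : R) : compact [set: K] -> 0 < e ->
  \forall g \near g0, forall x, nrm (translate a g f x - translate a g0 f x) < e.
Proof.
move=> cK e0.
apply: (@compact_uniform_near _ _ _ (fun p => f (a (p.1^-1)%g p.2))) => // p.
apply: (@continuous_comp _ _ _ (fun p : G * K => a (p.1^-1)%g p.2) f); last first.
  exact: cts_fun.
apply: (@continuous_comp _ _ _ (fun p : G * K => ((p.1^-1)%g, p.2))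
  (fun p : G * K => a p.1 p.2)); last exact: act_continuous.
apply: cvg_pair; last exact: cvg_snd.
apply: (@continuous_comp _ _ _ (fst : G * K -> G) (fun g : G => (g^-1)%g)).
  exact: cvg_fst.
exact: invg_continuous.
Qed.

Lemma translate_sep f h x0 : (forall g, translate a g f x0 = translate a g h x0) ->
  f = h.
Proof.
move=> fh; apply: CfunP => x; have [g <-] := act_transitive a x0 x.
by have := fh (g^-1)%g; rewrite !translateE invgK.
Qed.

End CfunTheory.

Section L2Theory.
Variables (R : realType) (G : topologicalGroupType) (K : ptopologicalType).
Variables (a : transitive_action G K) (mu : probability (borel K) R).
Hypotheses (compactK : compact [set: K]) (invmu : invariant_measure a mu).
Local Notation ip := (L2dot compactK invmu).
Implicit Types (f h : Cfun R K) (g : G).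

Lemma L2dot_translate g f h : ip (translate a g f) (translate a g h) = ip f h.
Proof. exact: L2inner_translate. Qed.

Lemma L2dot_translateV g f h : ip (translate a g f) h = ip f (translate a (g^-1)%g h).
Proof. by rewrite -(L2dot_translate g f) -translateM mulgV translate1. Qed.

Lemma L2dot_dom f h (r : K -> R) : continuous r ->
  (forall x, nrm (f x) * nrm (h x) <= r x) ->
  nrm (ip f h) <= \int[mu]_x r x.
Proof.
move=> rc fhr; apply: Cintegral_norm_le; last by move=> x; rewrite nrmM nrmJ.
- by apply: L2fun_mul; exact: Cfun_L2.
- exact: continuous_integrable.
Qed.

Lemma L2dot_le f h (A B : R) : 0 <= A ->
  (forall x, nrm (f x) <= A) -> (forall x, nrm (h x) <= B) ->
  nrm (ip f h) <= A * B.
Proof.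
move=> A0 fA hB; have -> : A * B = \int[mu]_x (A * B).
  by rewrite Rintegral_cst// [X in fine X](probability_setT mu) mulr1.
apply: L2dot_dom; first exact: cst_continuous.
by move=> x; rewrite ler_pM// nrm_ge0.
Qed.

End L2Theory.

(** * Invariant kernels *)

Section InvariantKernel.
Variables (R : realType) (G : topologicalGroupType) (K : ptopologicalType).
Variables (a : transitive_action G K) (f : Cfun R K).
Hypotheses (compactG : compact [set: G]) (compactK : compact [set: K]).
Implicit Types (x y z : K) (g : G).

(** The supremum over the whole group makes the pseudometric invariant; compactness of [G] keeps it
    continuous ([orbit_dist_near]). *)
Definition orbit_dist x y : R :=
  sup (range (fun g => nrm (f (a g x) - f (a g y)))).

Local Notation d := orbit_dist.

Let has_sup_orbit x y : has_sup (range (fun g => nrm (f (a g x) - f (a g y)))).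
Proof.
split; first by exists (nrm (f (a 1%g x) - f (a 1%g y))); exists 1%g.
have [M M0 fM] := Cfun_bounded f compactK.
exists (M + M) => _ [g _ <-]; apply: le_trans (nrmD _ _) _.
by rewrite lerD// -[- _]sub0r nrmB subr0.
Qed.

Lemma orbit_dist_ge x y g : nrm (f (a g x) - f (a g y)) <= d x y.
Proof. by apply: sup_upper_bound; [exact: has_sup_orbit | exists g]. Qed.

Lemma orbit_dist_le x y (c : R) :
  (forall g, nrm (f (a g x) - f (a g y)) <= c) -> d x y <= c.
Proof.
move=> H; apply: ge_sup; first by case: (has_sup_orbit x y).
by move=> _ [g _ <-].
Qed.

Lemma orbit_dist_ge0 x y : 0 <= d x y.
Proof. exact: le_trans (nrm_ge0 _) (orbit_dist_ge x y 1%g). Qed.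

Lemma orbit_dist_base x y : nrm (f x - f y) <= d x y.
Proof. by have := orbit_dist_ge x y 1%g; rewrite !act1. Qed.

Lemma orbit_distxx x : d x x = 0.
Proof.
apply/le_anti; rewrite orbit_dist_ge0 andbT; apply: orbit_dist_le => g.
by rewrite subrr -[0]/(toC 0) nrm_toC normr0.
Qed.

Lemma orbit_distC x y : d x y = d y x.
Proof.
by apply/le_anti/andP; split; apply: orbit_dist_le => g; rewrite nrmB;
  exact: orbit_dist_ge.
Qed.

Lemma orbit_dist_triangle x y z : d x z <= d x y + d y z.
Proof.
apply: orbit_dist_le => g; rewrite -(subrK (f (a g y)) (f (a g x))) -addrA.
by apply: le_trans (nrmD _ _) _; rewrite lerD// orbit_dist_ge.
Qed.

Lemma orbit_dist_act g x y : d (a g x) (a g y) = d x y.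
Proof.
have H h z t : d (a h z) (a h t) <= d z t.
  by apply: orbit_dist_le => k; rewrite -!actM; exact: orbit_dist_ge.
apply/le_anti; rewrite H/= -{1}(actK a g x) -{1}(actK a g y).
exact: H.
Qed.

Lemma orbit_dist_near y (e : R) : 0 < e -> \forall z \near y, d y z < e.
Proof.
move=> e0; have e2 : 0 < e / 2 by rewrite divr_gt0.
have : continuous (fun p : K * G => f (a p.2 p.1)).
  move=> p; apply: (@continuous_comp _ _ _ (fun p : K * G => a p.2 p.1) f);
    last exact: cts_fun.
  apply: (@continuous_comp _ _ _ (fun p : K * G => (p.2, p.1))
    (fun p : G * K => a p.1 p.2)); last exact: act_continuous.
  by apply: cvg_pair; [exact: cvg_snd | exact: cvg_fst].
move=> /(compact_uniform_near y compactG)/(_ e2); apply: filterS => z H.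
rewrite orbit_distC; apply: (@le_lt_trans _ _ (e / 2)).
  by apply: orbit_dist_le => g; exact/ltW/H.
by rewrite ltr_pdivrMr// ltr_pMr// ltr1n.
Qed.

Lemma orbit_dist_lip x y z : `|d x y - d x z| <= d y z.
Proof.
rewrite ler_norml lerBlDr lerNl opprB lerBlDr.
by rewrite addrC orbit_dist_triangle addrC (orbit_distC y z) orbit_dist_triangle.
Qed.

(** A tent of height and radius [e] around [x]. Depending on [d] alone, it is invariant under the
    diagonal action and 1-Lipschitz. *)
Definition bump (e : R) x y : R := Num.max (e - d x y) 0.

Lemma bump_ge0 e x y : 0 <= bump e x y.
Proof. by rewrite le_max lexx orbT. Qed.

Lemma bumpC e x y : bump e x y = bump e y x.
Proof. by rewrite /bump orbit_distC. Qed.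

Lemma bumpxx e x : 0 < e -> bump e x x = e.
Proof. by move=> e0; rewrite /bump orbit_distxx subr0 max_l// ltW. Qed.

Lemma bump_gt0 e x y : (0 < bump e x y) = (d x y < e).
Proof. by rewrite lt_max ltxx orbF subr_gt0. Qed.

Lemma bump_act e g x y : bump e (a g x) (a g y) = bump e x y.
Proof. by rewrite /bump orbit_dist_act. Qed.

Lemma bump_lip e x y z : `|bump e x y - bump e x z| <= d y z.
Proof.
suff H u v : `|Num.max u 0 - Num.max v 0| <= `|u - v| :> R.
  apply: le_trans (H _ _) _.
  by rewrite opprB addrC addrA subrK distrC orbit_dist_lip.
by case: (leP u 0) => u0; case: (leP v 0) => v0; case: (ger0P (u - v)) => uv;
  rewrite ?ler_norml; lra.
Qed.

Lemma bump_continuous e x : continuous (bump e x).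
Proof.
move=> y; apply/cvgrPdist_lt => r r0; apply: filterS (orbit_dist_near y r0) => z.
exact/le_lt_trans/bump_lip.
Qed.

Definition bump_fun (e : R) x : Cfun R K :=
  mkcts (continuous_toC (@bump_continuous e x)).

(** Bumps around the finitely many centres of a subcover by [d]-balls, divided by their sum, which
    is positive by the covering property. *)
Lemma partition_of_unity (e : R) : 0 < e ->
  exists n (y : 'I_n -> K) (h : 'I_n -> K -> R),
    [/\ forall i, continuous (h i), forall i x, 0 <= h i x,
        forall x, \sum_(i < n) h i x = 1
      & forall i x, d x (y i) < e \/ h i x = 0].
Proof.
move=> e0; have := compactK; rewrite compact_cover.
move=> /(_ K setT (fun y => [set z | d y z < e])).
case=> [y _||D _ Dcov].
- rewrite (_ : [set z | d y z < e] = bump e y @^-1` `]0, +oo[%classic).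
    by move/continuousP: (@bump_continuous e y); apply; exact: interval_open.
  by apply/seteqP; split=> z /=; rewrite in_itv/= andbT bump_gt0.
- by move=> y _; exists y => //=; rewrite orbit_distxx.
pose y (i : 'I_(size D)) := tnth (in_tuple D) i.
pose W x := \sum_(i < size D) bump e (y i) x.
have W0 x : 0 < W x.
  have [z /= zD dzx] := Dcov x I.
  have /tnthP[i zi] : z \in in_tuple D by exact: zD.
  rewrite /W (bigD1 i)//= ltr_pwDl//; first by rewrite bump_gt0 /y -zi.
  by rewrite sumr_ge0// => j _; exact: bump_ge0.
have Wc : continuous W.
  apply: continuous_big => [|i _]; [exact: add_continuous | exact: bump_continuous].
exists (size D), y, (fun i x => bump e (y i) x / W x); split.
- move=> i x; apply: cvgM; first exact: bump_continuous.
  by apply: cvgV; [rewrite gt_eqF | exact: Wc].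
- by move=> i x; rewrite divr_ge0 ?bump_ge0 ?ltW.
- by move=> x; rewrite -mulr_suml -/(W x) divff ?gt_eqF.
move=> i x; case: (ltP (d x (y i)) e) => dxy; [by left | right].
by rewrite /bump orbit_distC max_r ?mul0r// subr_le0.
Qed.

End InvariantKernel.

Lemma nrm_sum (R : realType) n (F : 'I_n -> Cplx R) :
  nrm (\sum_(i < n) F i) <= \sum_(i < n) nrm (F i).
Proof.
elim/big_rec2 : _ => [|i x y _ H]; first by rewrite -[0]/(toC 0) nrm_toC normr0.
by apply: le_trans (nrmD _ _) _; rewrite lerD2l.
Qed.

Lemma toC_sum (R : realType) n (F : 'I_n -> R) :
  toC (\sum_(i < n) F i) = \sum_(i < n) toC (F i).
Proof. by elim/big_rec2 : _ => // i x y _ <-; rewrite toCD. Qed.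

(** * Kernel approximation and adjoints of equivariant operators *)

Section Approximation.
Variables (R : realType) (G : topologicalGroupType) (K : ptopologicalType).
Variables (a : transitive_action G K) (mu : probability (borel K) R) (x0 : K).
Hypotheses (compactG : compact [set: G]) (compactK : compact [set: K]).
Hypothesis invmu : invariant_measure a mu.
Local Notation ip := (L2dot compactK invmu).
Variable f : Cfun R K.
Local Notation d := (orbit_dist a f).
Local Notation k := (bump_fun a f compactG compactK).

Lemma lipschitz_continuous (u : K -> Cplx R) (B : R) : 0 <= B ->
  (forall y z, nrm (u y - u z) <= B * d y z) -> continuous u.
Proof.
move=> B0 uB y; apply/cvgrPdist_lt => _ /lt_toC[e e0 ->].
have B1 : 0 < B + 1 by rewrite ltr_wpDl.
have eB : 0 < e / (B + 1) by rewrite divr_gt0.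
apply: filterS (orbit_dist_near a f compactG compactK y eB) => z.
rewrite ltr_pdivlMr// -nrm_lt => dz; apply: le_lt_trans (uB _ _) _.
apply: le_lt_trans dz; rewrite mulrC ler_wpM2l ?lerDl//.
exact: orbit_dist_ge0.
Qed.

(** The combination of the [h i] with coefficients [u (y i)] is uniformly within [B * delta] of [u]:
    the [h i] sum to 1, and [h i] vanishes at all points at distance [delta] or more from [y i]. *)
Lemma riemann_sum n (y : 'I_n -> K) (h : 'I_n -> K -> R) (delta : R)
    (hc : forall i, continuous (h i)) (u : Cfun R K) (B M : R) :
  (forall i x, 0 <= h i x) -> (forall x, \sum_(i < n) h i x = 1) ->
  (forall i x, d x (y i) < delta \/ h i x = 0) ->
  0 <= B -> (forall y z, nrm (u y - u z) <= B * d y z) ->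
  0 <= M -> (forall x, nrm (f x) <= M) ->
  nrm (ip f u - \sum_(i < n) ip f (mkcts (continuous_toC (hc i))) * (u (y i))^*)
    <= M * (B * delta).
Proof.
move=> h0 h1 hd B0 uB M0 fM.
pose H i : Cfun R K := mkcts (continuous_toC (hc i)).
rewrite (_ : _ - _ = ip f (u - \sum_(i < n) u (y i) *: H i)); last first.
  rewrite dotBr dot_sumr; congr (_ - _); apply: eq_bigr => i _.
  by rewrite dotZr mulrC.
apply: L2dot_le => // x; rewrite CfunBE Cfun_sumE.
have -> : u x - \sum_(i < n) (u (y i) *: H i) x =
    \sum_(i < n) toC (h i x) * (u x - u (y i)).
  rewrite -[u x in LHS]mul1r -[1 in LHS]/(toC 1) -(h1 x) toC_sum mulr_suml.
  rewrite -sumrB; apply: eq_bigr => i _.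
  by rewrite mulrBr CfunZE [X in _ - X]mulrC.
apply: le_trans (nrm_sum _) _.
rewrite -[leRHS]mul1r -(h1 x) mulr_suml; apply: ler_sum => i _.
rewrite nrmM nrm_toC ger0_norm//.
have [dxy|->] := hd i x; last by rewrite !mul0r.
apply: ler_wpM2l => //; apply: le_trans (uB _ _) _.
by apply: ler_wpM2l => //; exact: ltW.
Qed.

Lemma bump_funE e y x : k e y x = toC (bump a f e y x).
Proof. by []. Qed.

Lemma bump_fun_dist e y z x : nrm (k e y x - k e z x) <= d y z.
Proof.
rewrite !bump_funE -toCB nrm_toC (bumpC a f compactK) (bumpC a f compactK e z).
exact: bump_lip.
Qed.

Lemma bump_fun_translate e g y : translate a g (k e y) = k e (a g y).
Proof.
apply: CfunP => x; rewrite translateE !bump_funE.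
by rewrite -{2}(actVK a g x) bump_act.
Qed.

(** Invariance moves the centre [x] to [x0], so that one normalizing constant serves all points. *)
Lemma bump_mass e x : \int[mu]_y bump a f e x y = \int[mu]_y bump a f e x0 y.
Proof.
have [g <-] := act_transitive a x0 x.
rewrite -[LHS](Rintegral_act compactK invmu g).
  by congr Rintegral; apply/funext => y; rewrite bump_act.
exact: bump_continuous.
Qed.

(** The integral is the squared L2 norm of the square root of the bump, which does not vanish at
    [x0]. *)
Lemma bump_mass_gt0 e : 0 < e -> 0 < \int[mu]_y bump a f e x0 y.
Proof.
move=> e0; pose r := fun y => Num.sqrt (bump a f e x0 y).
have rc : continuous r.
  move=> y; apply: (@continuous_comp _ _ _ (bump a f e x0) Num.sqrt).
    exact: bump_continuous.
  exact: sqrt_continuous.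
pose s : Cfun R K := mkcts (continuous_toC rc).
have s0 : s != 0.
  apply/eqP => /(congr1 (fun h : Cfun R K => complex.Re (h x0))) /= /eqP.
  by rewrite /r bumpxx// sqrtr_eq0 leNgt e0.
have := L2inner_gt0 compactK invmu s0.
rewrite (@L2inner_real _ _ _ _ _ (bump a f e x0)) ?(toC_lt 0)// => y.
by rewrite /= toCJ -toCM -expr2 sqr_sqrtr// bump_ge0.
Qed.

Section Operator.
Variables (Q : {linear Cfun R K -> Cfun R K}) (C : R).
Hypotheses (C0 : 0 <= C) (QC : forall (h : Cfun R K) (M : R),
  (forall x, nrm (h x) <= M) -> forall x, nrm (Q h x) <= C * M).
Hypothesis Qeqv : forall g h, Q (translate a g h) = translate a g (Q h).
Variable e : R.

(* A substitute for the Hilbert space adjoint of [Q], which need not exist as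
   [Q] is bounded for the uniform norm only: [k e y] plays the role of a point
   mass at [y], and [<s, Q (k e y)>] that of the value at [y] of the adjoint
   applied to [s]. *)
Definition kernel_adjoint_fun (h : Cfun R K) (y : K) : Cplx R := ip h (Q (k e y)).

(** In the uniform norm [k e y] is 1-Lipschitz in [y], and [Q] stretches by at most the factor
    [C]. *)
Lemma kernel_adjoint_lip (h : Cfun R K) (M : R) : 0 <= M ->
  (forall x, nrm (h x) <= M) -> forall y z,
  nrm (kernel_adjoint_fun h y - kernel_adjoint_fun h z) <= M * C * d y z.
Proof.
move=> M0 hM y z; rewrite /kernel_adjoint_fun -dotBr -linearB -mulrA.
by apply: L2dot_le => //; apply: QC => x; exact: bump_fun_dist.
Qed.

Lemma kernel_adjoint_continuous (h : Cfun R K) : continuous (kernel_adjoint_fun h).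
Proof.
have [M M0 hM] := Cfun_bounded h compactK.
apply: (@lipschitz_continuous _ (M * C)); first exact: mulr_ge0.
exact: kernel_adjoint_lip.
Qed.

Definition kernel_adjoint (h : Cfun R K) : Cfun R K :=
  mkcts (@kernel_adjoint_continuous h).

Lemma kernel_adjointE (h : Cfun R K) y : kernel_adjoint h y = ip h (Q (k e y)).
Proof. by []. Qed.

Lemma kernel_adjointP c (h h' : Cfun R K) :
  kernel_adjoint (c *: h + h') = c *: kernel_adjoint h + kernel_adjoint h'.
Proof.
by apply: CfunP => y; rewrite CfunE !kernel_adjointE dotDl dotZl.
Qed.

Lemma kernel_adjoint_equivariant g h :
  kernel_adjoint (translate a g h) = translate a g (kernel_adjoint h).
Proof.
apply: CfunP => y; rewrite translateE !kernel_adjointE.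
by rewrite -bump_fun_translate Qeqv L2dot_translateV.
Qed.

Lemma kernel_adjoint_estimate (s : Cfun R K) (Ms : R) : 0 < e -> 0 <= Ms ->
  (forall x, nrm (s x) <= Ms) -> ip f (kernel_adjoint s) = 0 ->
  nrm (ip (Q f) s) <= C * Ms * e.
Proof.
(* [c f] is uniformly within [e c] of the average of the [k e y] weighted by [f],
   hence of a Riemann sum [fd] of that average; the same Riemann sum turns
   [<Q fd, s>] into [<f, kernel_adjoint s>]. *)
move=> e0 Ms0 sM fs; set c := \int[mu]_y bump a f e x0 y.
have c0 : 0 < c := bump_mass_gt0 e0.
have [M M0 fM] := Cfun_bounded f compactK.
pose phi (h : Cfun R K) := ip (Q h) s.
have phi_le (h : Cfun R K) N : (forall x, nrm (h x) <= N) -> nrm (phi h) <= C * N * Ms.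
  move=> hN; apply: L2dot_le => //; last exact: QC.
  by rewrite mulr_ge0// (le_trans (nrm_ge0 (h x0))).
(* The term in [delta] is the error of the Riemann sums; letting [delta] tend to 0 leaves the claim
   multiplied by [c]. *)
suff H delta : 0 < delta ->
    c * nrm (phi f) <= C * Ms * e * c + 2 * (C * Ms * M) * delta.
  rewrite -(ler_pM2l c0) [leRHS]mulrC.
  apply/ler_addgt0Pr => r r0.
  have B0 : 0 <= 2 * (C * Ms * M) by rewrite !mulr_ge0.
  move: (2 * _) B0 H => B B0 H.
  have B1 : 0 < B + 1 by rewrite ltr_wpDl.
  apply: le_trans (H (r / (B + 1)) (divr_gt0 r0 B1)) _.
  by rewrite lerD2l mulrCA ler_piMr ?(ltW r0)// ler_pdivrMr// mul1r lerDl.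
move=> delta0.
have [n [y [h [hc h0 h1 hd]]]] := partition_of_unity a f compactG compactK delta0.
pose H i : Cfun R K := mkcts (continuous_toC (hc i)).
pose fd := \sum_(i < n) ip f (H i) *: k e (y i).
have fd_near x : nrm ((toC c *: f - fd) x) <= e * c + M * delta.
  rewrite CfunBE CfunZE -(subrK (ip f (k e x)) (_ * _)) -addrA.
  apply: le_trans (nrmD _ _) _; apply: lerD.
    (* As [<1, k e x> = c], the difference is the product of the function [f x - f] with [k e x],
       and [f] differs from [f x] by less than [e] where the bump is positive. *)
    pose one : Cfun R K := mkcts (@cst_continuous _ _ (1 : Cplx R)).
    have -> : toC c * f x - ip f (k e x) = ip (f x *: one - f) (k e x).
      rewrite dotBl dotZl mulrC; congr (_ * _ - _).
      rewrite /c -(bump_mass e x) -(@L2inner_real _ _ _ one (k e x))// => z.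
      by rewrite bump_funE toCJ mul1r.
    have -> : e * c = \int[mu]_z (e * bump a f e x z).
      rewrite /c -(bump_mass e x) RintegralZl//.
      apply: continuous_integrable => //; exact: bump_continuous.
    apply: L2dot_dom.
      by move=> z; apply: cvgM; [exact: cvg_cst | exact: bump_continuous].
    move=> z; rewrite CfunBE CfunZE mulr1 bump_funE nrm_toC ger0_norm ?bump_ge0//.
    have := bump_ge0 a f e x z; rewrite le_eqVlt => /predU1P[<-|].
      by rewrite !mulr0.
    rewrite bump_gt0 => dxz; apply: ler_wpM2r; first exact: bump_ge0.
    apply: le_trans (ltW dxz).
    exact: orbit_dist_base.
  have -> : fd x = \sum_(i < n) ip f (H i) * (k e x (y i))^*.
    rewrite Cfun_sumE; apply: eq_bigr => i _.
    by rewrite CfunZE !bump_funE toCJ (bumpC a f compactK).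
  rewrite -[delta]mul1r; apply: riemann_sum => // z t.
  by rewrite mul1r !bump_funE -toCB nrm_toC; exact: bump_lip.
have fd_phi : nrm (phi fd) <= M * (Ms * C * delta).
  (* Since [<f, kernel_adjoint s> = 0], [phi fd] is, up to sign, the error of the Riemann sum for
     this product. *)
  have -> : phi fd = - (ip f (kernel_adjoint s) -
      \sum_(i < n) ip f (H i) * (kernel_adjoint s (y i))^*).
    rewrite fs sub0r opprK /phi linear_sum dot_suml; apply: eq_bigr => i _.
    by rewrite linearZ dotZl kernel_adjointE [ip (Q _) s]dotC.
  rewrite -[- _]sub0r nrmB subr0; apply: riemann_sum => //.
    exact: mulr_ge0.
  exact: kernel_adjoint_lip.
have -> : c * nrm (phi f) = nrm (phi (toC c *: f - fd) + phi fd).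
  rewrite -[c in LHS]ger0_norm ?(ltW c0)// -nrm_toC -nrmM; congr nrm.
  by rewrite /phi linearB linearZ dotBl dotZl subrK.
apply: le_trans (nrmD _ _) _; apply: le_trans (lerD (phi_le _ _ fd_near) fd_phi) _.
by rewrite le_eqVlt; apply/orP; left; apply/eqP; ring.
Qed.

End Operator.
End Approximation.

(** * Finite-dimensional invariant subspaces *)

(* An alias is needed since the library norms matrices with the maximum norm. *)
Definition euclidean (R : realType) (n : nat) : Type := 'rV[Cplx R]_n.

Section Euclidean.
Variables (R : realType) (n : nat).
Local Notation E := (euclidean R n).

HB.instance Definition _ := GRing.Lmodule.on E.

Definition coord (v : E) (i : 'I_n) : Cplx R := (v : 'rV[Cplx R]_n) 0 i.

Definition of_coord (c : 'I_n -> Cplx R) : E := (\row_i c i : 'rV[Cplx R]_n).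

Lemma of_coordK c i : coord (of_coord c) i = c i.
Proof. by rewrite /coord mxE. Qed.

Lemma coordP (c : Cplx R) (u v : E) i : coord (c *: u + v) i = c * coord u i + coord v i.
Proof. by rewrite /coord !mxE. Qed.

Lemma coord_inj (u v : E) : coord u =1 coord v -> u = v.
Proof. by move=> uv; apply/rowP => i; exact: uv. Qed.

Definition edot (u v : E) : Cplx R := \sum_(i < n) coord u i * (coord v i)^*.

Lemma edot_bilinear : bilinear_for (GRing.Scale.Law.clone _ _ *%R _)
  (GRing.Scale.Law.clone _ _ (@Num.conj (Cplx R) \; *%R) _) edot.
Proof.
split=> [v|v] c u u' /=; rewrite /edot mulr_sumr -big_split /=.
  by apply: eq_bigr => i _; rewrite coordP mulrDl mulrA.
by apply: eq_bigr => i _; rewrite coordP rmorphD rmorphM mulrDr mulrCA.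
Qed.

HB.instance Definition _ :=
  bilinear_isBilinear.Build _ _ _ _ _ _ edot edot_bilinear.

Lemma edot_hermitian (u v : E) : edot u v = (-1) ^+ false * (edot v u)^*.
Proof.
rewrite expr0 mul1r /edot rmorph_sum; apply: eq_bigr => i _.
by rewrite rmorphM/= conjCK mulrC.
Qed.

HB.instance Definition _ :=
  isHermitianSesquilinear.Build _ _ _ _ edot edot_hermitian.

Lemma edot_gt0 (u : E) : u != 0 -> 0 < edot u u.
Proof.
move=> u0; have [i ui] : exists i, coord u i != 0.
  apply: contrapT => H; move/eqP: u0; apply; apply: coord_inj => i.
  rewrite [RHS]mxE; apply/eqP; apply: contrapT => ui; apply: H.
  by exists i; apply/negP.
rewrite /edot (bigD1 i)//= ltr_pwDl//.
  by rewrite -normCK exprn_gt0// normr_gt0.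
by rewrite sumr_ge0// => j _; rewrite -normCK exprn_ge0.
Qed.

HB.instance Definition _ := isDotProduct.Build _ _ edot edot_gt0.

Definition euclidean_dot : {dot E for @Num.conj (Cplx R)} := edot.

Definition enorm (v : E) : Cplx R := sqrtC (edot v v).

Lemma enorm_ge0 v : 0 <= enorm v.
Proof. by rewrite sqrtC_ge0; exact: (dnorm_ge0 euclidean_dot). Qed.

Lemma enormD u v : enorm (u + v) <= enorm u + enorm v.
Proof.
have uv0 : 0 <= enorm u + enorm v by rewrite addr_ge0 ?enorm_ge0.
rewrite -(ler_pXn2r (n := 2)) ?nnegrE ?enorm_ge0//.
rewrite sqrrD !sqrtCK.
have -> : edot (u + v) (u + v) =
  edot u u + edot v v + (edot u v + (edot u v)^*) by exact: (dnormD euclidean_dot).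
rewrite [leRHS]addrAC lerD2l.
have dr : edot u v + (edot u v)^* \is Num.real.
  by rewrite CrealE rmorphD/= conjCK addrC.
apply: le_trans (real_ler_norm dr) _; apply: le_trans (ler_normD _ _) _.
rewrite norm_conjC -mulr2n lerMn2r/=.
rewrite -(ler_pXn2r (n := 2)) ?nnegrE ?mulr_ge0 ?enorm_ge0//.
rewrite exprMn !sqrtCK.
exact: (dot_cauchy_schwarz euclidean_dot).
Qed.

Lemma enormZ (c : Cplx R) v : enorm (c *: v) = `|c| * enorm v.
Proof.
rewrite /enorm (dnormZ euclidean_dot) rootCMl ?exprn_ge0//.
by rewrite sqrCK.
Qed.

Lemma enorm0_eq0 v : enorm v = 0 -> v = 0.
Proof.
move=> /eqP; rewrite sqrtC_eq0 => v0; apply/eqP.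
by have := dnorm_eq0 euclidean_dot v; rewrite v0 => /esym.
Qed.

HB.instance Definition _ :=
  Lmodule_isNormed.Build (Cplx R) E enormD enormZ enorm0_eq0.

Lemma euclidean_normE (v : E) : `|v| ^+ 2 = euclidean_dot v v.
Proof. exact: sqrtCK. Qed.

Lemma coord_le_norm (v : E) i : `|coord v i| <= `|v|.
Proof.
rewrite -(ler_pXn2r (n := 2)) ?nnegrE// euclidean_normE.
rewrite [leRHS]/(edot v v) /edot (bigD1 i)//= -normCK lerDl.
by rewrite sumr_ge0// => j _; rewrite -normCK exprn_ge0.
Qed.

Lemma norm_le_coord (v : E) : `|v| <= \sum_(i < n) `|coord v i|.
Proof.
rewrite -(ler_pXn2r (n := 2)) ?nnegrE ?sumr_ge0// euclidean_normE.
rewrite [leLHS]/(edot v v) /edot expr2 mulr_suml.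
apply: ler_sum => i _; rewrite -normCK expr2 ler_wpM2l// (bigD1 i)//= lerDl.
by rewrite sumr_ge0.
Qed.

(** Real and imaginary parts of the coordinates are 1-Lipschitz, hence converge along [F], and their
    limits assemble to a limit of [F]. *)
Lemma euclidean_complete (F : set_system E) : ProperFilter F -> cauchy F -> cvg F.
Proof.
move=> FF /cauchyP Fc.
have re_cvg (p : Cplx R -> R) : (forall z w, `|p z - p w| <= nrm (z - w)) ->
    forall i, cvg ((fun v : E => p (coord v i)) @ F).
  move=> plip i; apply/cauchy_cvgP/cauchyP => e e0.
  have e1 : 0 < toC e by rewrite (toC_lt 0).
  have [u Fu] := Fc _ e1; exists (p (coord u i)).
  suff : \forall v \near F, ball (p (coord u i)) e (p (coord v i)) by [].
  apply: filterS Fu => v uv.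
  have {}uv : `|u - v| < toC e by move: uv; rewrite -ball_normE.
  rewrite -ball_normE /=.
  apply: le_lt_trans (plip _ _) _; rewrite nrm_lt.
  apply: le_lt_trans uv; rewrite (_ : _ - _ = coord (u - v) i) ?coord_le_norm//.
  by rewrite /coord !mxE.
have reP z w : `|complex.Re z - complex.Re w| <= nrm (z - w) :> R.
  by rewrite -cReB Re_le_nrm.
have imP z w : `|complex.Im z - complex.Im w| <= nrm (z - w) :> R.
  by rewrite -cImB Im_le_nrm.
pose re i := lim ((fun v : E => complex.Re (coord v i)) @ F).
pose im i := lim ((fun v : E => complex.Im (coord v i)) @ F).
apply/cvg_ex; exists (of_coord (fun i => Complex (re i) (im i))).
apply/cvgrPdist_lt => _ /lt_toC[e e0 ->].
(* The norm is bounded by [2 * n] real terms; [n.+1] in the denominator keeps the final inequality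
   strict and covers [n = 0]. *)
have en : 0 < e / (2 * n.+1%:R) by rewrite divr_gt0// mulr_gt0.
have near_re i : \forall v \near F,
    `|re i - complex.Re (coord v i)| < e / (2 * n.+1%:R).
  by move: (re_cvg _ reP i) => /cvgrPdist_lt; apply.
have near_im i : \forall v \near F,
    `|im i - complex.Im (coord v i)| < e / (2 * n.+1%:R).
  by move: (re_cvg _ imP i) => /cvgrPdist_lt; apply.
apply: filterS (filterI (filter_forall _ near_re) (filter_forall _ near_im)).
move=> v [vre vim].
apply: le_lt_trans (norm_le_coord _) _.
under eq_bigr do rewrite -nrmE.
rewrite -toC_sum toC_lt.
apply: (@le_lt_trans _ _ (\sum_(i < n) e / n.+1%:R)).
  apply: ler_sum => i _; apply: le_trans (nrm_le_ReIm _) _.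
  rewrite (_ : coord _ i = Complex (re i) (im i) - coord v i); last first.
    by rewrite /coord !mxE.
  rewrite cReB cImB /=; apply: le_trans (lerD (ltW (vre i)) (ltW (vim i))) _.
  by rewrite le_eqVlt; apply/orP; left; apply/eqP; field.
rewrite sumr_const card_ord -[ltLHS]mulr_natr -mulrA gtr_pMr//.
by rewrite ltr_pdivrMl// mulr1 ltr_nat.
Qed.

HB.instance Definition _ := Uniform_isComplete.Build E euclidean_complete.

Definition euclidean_hilbert : hilbertSpace R :=
  @HilbertSpace R E euclidean_dot euclidean_normE.

End Euclidean.

(** Trades the supremum of sizes of independent families for the dependence of any two vectors, the
    form in which both implications handle the multiplicity bound. *)
Lemma dimension_le1 (R : realType) (V : lmodType (Cplx R)) (W : set V) :
  (dimension W <= 1)%E <-> forall u v, W u -> W v ->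
    exists c1 c2 : Cplx R, (c1 != 0) || (c2 != 0) /\ c1 *: u + c2 *: v = 0.
Proof.
split=> [W1 u v Wu Wv|H].
  apply: contrapT => uv; pose e (i : 'I_2) := if i == ord0 then u else v.
  suff W2 : (2%:R%:E <= dimension W)%E.
    by have := le_trans W2 W1; rewrite lee_fin leNgt ltr1n.
  apply: ereal_sup_ubound.
  exists 2%N => //; exists e; split; first by move=> i; rewrite /e; case: ifP.
  move=> c; rewrite big_ord_recl big_ord1 /e /= => ce i.
  apply: contrapT => ci; apply: uv; exists (c ord0), (c (lift ord0 ord0)).
  split=> //; apply/orP; case: (unliftP ord0 i) => [j|] ij; [right|left];
    by apply/eqP => c0; apply: ci; rewrite ij ?ord1.
apply: ge_ereal_sup => _ [n [e [We eI]] <-]; rewrite lee_fin.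
case: n e We eI => [|[|n]] e We eI; rewrite ?ler01//.
pose i0 : 'I_n.+2 := ord0; pose i1 : 'I_n.+2 := lift ord0 ord0.
have [c1 [c2 [c12 ce]]] := H _ _ (We i0) (We i1).
pose c (i : 'I_n.+2) := if i == i0 then c1 else if i == i1 then c2 else 0.
have c0 : forall i, c i = 0.
  apply: eI; rewrite (bigD1 i0)//= (bigD1 i1)//= big1 ?addr0 => [|i /andP[i_0 i_1]].
    by rewrite /c eqxx.
  by rewrite /c (negbTE i_0) (negbTE i_1) scale0r.
by move: c12 (c0 i0) (c0 i1); rewrite /c !eqxx /= => /orP[]/eqP c_0 ? ?; case: c_0.
Qed.

(** * Invariant subspaces as unitary representations *)

Section Coordinates.
Variables (R : realType) (G : topologicalGroupType) (K : ptopologicalType).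
Variables (a : transitive_action G K) (mu : probability (borel K) R).
Hypotheses (compactK : compact [set: K]) (invmu : invariant_measure a mu).
Local Notation ip := (L2dot compactK invmu).
Variables (n : nat) (e : 'I_n -> Cfun R K).
Hypotheses (eON : orthonormal_family ip e) (einv : invariant_subset a (span e)).
Local Notation V := (euclidean R n).
Implicit Types (u v : V) (g : G).

Definition emb v : Cfun R K := \sum_(i < n) coord v i *: e i.

Definition unemb (f : Cfun R K) : V := of_coord (fun i => ip f (e i)).

Lemma embP c u v : emb (c *: u + v) = c *: emb u + emb v.
Proof.
rewrite /emb scaler_sumr -big_split; apply: eq_bigr => i _.
by rewrite coordP scalerDl scalerA.
Qed.

Lemma emb_span v : span e (emb v).
Proof. by exists (coord v). Qed.

Lemma unembK f : span e f -> emb (unemb f) = f.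
Proof.
move=> /(on_coord eON) {2}->; apply: eq_bigr => i _; by rewrite of_coordK.
Qed.

Lemma embK v : unemb (emb v) = v.
Proof. by apply: coord_inj => i; rewrite of_coordK dot_sum_on. Qed.

Lemma emb_isometry u v : ip (emb u) (emb v) = euclidean_dot R n u v.
Proof.
rewrite (on_parseval eON _ (emb_span u)); apply: eq_bigr => i _.
by rewrite !dot_sum_on.
Qed.

Lemma unembP c f h : unemb (c *: f + h) = c *: unemb f + unemb h.
Proof.
by apply: coord_inj => i; rewrite coordP !of_coordK dotDl dotZl.
Qed.

(** As [multiplicity_free] quantifies over Hilbert spaces, the translation action on [span e] is
    carried over to coordinates in the orthonormal family. *)
Definition subrep_fun g v : V := unemb (translate a g (emb v)).

Lemma emb_subrep g v : emb (subrep_fun g v) = translate a g (emb v).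
Proof. by rewrite unembK//; apply: einv; exact: emb_span. Qed.

Lemma subrep_linear g : linear (subrep_fun g).
Proof.
by move=> c u v; rewrite /subrep_fun embP translateP unembP.
Qed.

Definition subrep_lin g : {linear euclidean_hilbert R n -> euclidean_hilbert R n} :=
  HB.pack (subrep_fun g) (GRing.isLinear.Build _ _ _ _ (subrep_fun g) (subrep_linear g)).

Lemma subrep1 v : subrep_lin 1%g v = v.
Proof. by rewrite /= /subrep_fun translate1 embK. Qed.

Lemma subrepM g h v : subrep_lin (g * h)%g v = subrep_lin g (subrep_lin h v).
Proof. by rewrite /= /subrep_fun translateM emb_subrep. Qed.

Lemma subrep_unitary g u v : inner (euclidean_hilbert R n) (subrep_lin g u)
  (subrep_lin g v) = inner (euclidean_hilbert R n) u v.
Proof.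
rewrite -[LHS]/(euclidean_dot R n (subrep_fun g u) (subrep_fun g v)).
by rewrite -emb_isometry !emb_subrep L2dot_translate emb_isometry.
Qed.

(** Translation is continuous for the uniform norm, which dominates the L2 norm as [mu] is a
    probability. *)
Lemma subrep_continuous v :
  continuous (fun g => subrep_lin g v : euclidean_hilbert R n).
Proof.
move=> g0; apply/cvgrPdist_lt => _ /lt_toC[r r0 ->].
have r2 : 0 < r / 2 by rewrite divr_gt0.
apply: filterS (translate_near a (emb v) g0 compactK r2) => g H.
rewrite -(ltr_pXn2r (n := 2)) ?nnegrE ?toC_ge0 ?(ltW r0)//.
rewrite inner_norm -[ltLHS]/(euclidean_dot R n
  (subrep_fun g0 v - subrep_fun g v) (subrep_fun g0 v - subrep_fun g v)).
rewrite -emb_isometry.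
have -> : emb (subrep_fun g0 v - subrep_fun g v) =
    translate a g0 (emb v) - translate a g (emb v).
  by rewrite -scaleN1r addrC embP !emb_subrep scaleN1r addrC.
set w := _ - _.
have wr : forall x, nrm (w x) <= r / 2.
  by move=> x; rewrite /w CfunBE nrmB ltW// H.
have := L2dot_le compactK invmu (ltW r2) wr wr; rewrite nrm_le => wle.
apply: le_lt_trans (real_ler_norm (ger0_real (dnorm_ge0 ip w))) _.
apply: le_lt_trans wle _.
rewrite -toCX toC_lt -expr2 ltr_pXn2r ?nnegrE ?(ltW r2) ?(ltW r0)//.
by rewrite ltr_pdivrMr// ltr_pMr// ltr1n.
Qed.

Definition subrep : unitary_rep G (euclidean_hilbert R n) :=
  @UnitaryRep R G (euclidean_hilbert R n) subrep_lin
    subrep1 subrepM subrep_unitary subrep_continuous.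

End Coordinates.

Lemma rep_adjoint (R : realType) (G : topologicalGroupType) (V : hilbertSpace R)
    (pi : unitary_rep G V) g (u v : V) :
  inner V (pi g u) v = inner V u (pi (g^-1)%g v).
Proof. by rewrite -[in RHS](rep_unitary pi g) -repM mulgV rep1. Qed.

(** * Equivariant endomorphisms under multiplicity-freeness *)

Section Intertwiners.
Variables (R : realType) (G : topologicalGroupType) (K : ptopologicalType).
Variables (a : transitive_action G K) (mu : probability (borel K) R) (x0 : K).
Hypotheses (compactK : compact [set: K]) (invmu : invariant_measure a mu).
Hypothesis MF : multiplicity_free R a x0.
Local Notation ip := (L2dot compactK invmu).
Variable E : Cfun R K -> Cfun R K.
Hypothesis EP : forall c (f h : Cfun R K), E (c *: f + h) = c *: E f + E h.
Hypothesis Eeqv : forall g f, E (translate a g f) = translate a g (E f).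

Let E0 : E 0 = 0.
Proof. by have := EP (-1) 0 0; rewrite !scaleN1r !addNr. Qed.

Lemma intertwiner_emb n (e : 'I_n -> Cfun R K) v :
  E (emb e v) = \sum_(i < n) coord v i *: E (e i).
Proof.
rewrite /emb; elim/big_rec2 : _ => [|i x y _ <-]; first exact: E0.
exact: EP.
Qed.

(* Evaluating [s] and [E s] at [x0] gives two functionals on [span e] that are
   fixed by the stabilizer of [x0], hence proportional. *)
Lemma irreducible_stable n (e : 'I_n -> Cfun R K)
    (eON : orthonormal_family ip e) (einv : invariant_subset a (span e)) :
  irreducible (subrep eON einv) -> forall s, span e s -> span e (E s).
Proof.
move=> /MF /dimension_le1 H s es.
(* Riesz vectors of the two functionals; the conjugates offset the conjugate-linearity of the second
   argument. *)
pose u1 : euclidean R n := of_coord (fun i => (e i x0)^*).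
pose u2 : euclidean R n := of_coord (fun i => (E (e i) x0)^*).
have u1E v : euclidean_dot R n v u1 = emb e v x0.
  rewrite /emb Cfun_sumE; apply: eq_bigr => i _.
  by rewrite of_coordK conjCK CfunZE.
have u2E v : euclidean_dot R n v u2 = E (emb e v) x0.
  rewrite intertwiner_emb Cfun_sumE; apply: eq_bigr => i _.
  by rewrite of_coordK conjCK CfunZE.
(* For [h] fixing [x0], equivariance of [F] gives the functional the same value at a vector and at
   its translate by [h], so its Riesz vector is fixed. *)
have fixP (u : euclidean R n) (F : Cfun R K -> Cfun R K) :
    (forall g f, F (translate a g f) = translate a g (F f)) ->
    (forall v, euclidean_dot R n v u = F (emb e v) x0) ->
    fixed_vectors (subrep eON einv) (stabilizer a x0) u.
  move=> Feqv Fu h hx0; apply/eqP; rewrite -subr_eq0.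
  rewrite -(dnorm_eq0 (euclidean_dot R n)); apply/eqP.
  set w := _ - _; rewrite dotBr [X in _ - X]Fu; apply/eqP; rewrite subr_eq0.
  rewrite -[X in X == _]/(inner (euclidean_hilbert R n) w (subrep eON einv h u)).
  rewrite -[h]invgK -rep_adjoint.
  rewrite -[X in X == _]/(euclidean_dot R n (subrep_fun compactK invmu e (h^-1)%g w) u).
  by rewrite Fu emb_subrep// Feqv translateE invgK hx0.
have [c1 [c2 [c12 cu]]] := H u1 u2
  (fixP u1 id (fun _ _ => erefl) u1E) (fixP u2 E Eeqv u2E).
(* The relation holds at [x0] for every translate of [s], hence everywhere by transitivity. *)
have cs : c1^* *: s + c2^* *: E s = 0.
  apply: (translate_sep (a := a) (x0 := x0)) => g.
  pose v := unemb compactK invmu e (translate a g s).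
  have vs : emb e v = translate a g s by exact: (unembK eON (einv g s es)).
  have -> : translate a g (c1^* *: s + c2^* *: E s) x0 =
    c1^* * translate a g s x0 + c2^* * translate a g (E s) x0 by [].
  rewrite -Eeqv -vs -u1E -u2E -!dotZr -dotDr cu.
  exact: linear0r.
(* If [c2 = 0], then [c1] is nonzero and the relation forces [s = 0]. *)
have es2 : span e (E s) \/ c2 = 0.
  have [c2_0|c2_0] := eqVneq c2 0; [by right|left].
  have -> : E s = (- (c2^*)^-1 * c1^*) *: s + 0.
    apply: (scalerI (a := c2^*)); first by rewrite conjC_eq0.
    rewrite addr0 scalerA mulrA mulrN divff ?conjC_eq0// mulN1r scaleNr.
    by apply/eqP; rewrite -addr_eq0 addrC cs.
  by apply: (span_linear_subset e).2 => //; exact: (span_linear_subset e).1.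
case: es2 => // c2_0; move: c12 cs; rewrite c2_0 eqxx orbF conjC0 scale0r addr0.
move=> c1_0 /eqP; rewrite scaler_eq0 conjC_eq0 (negbTE c1_0) => /eqP ->.
by rewrite E0; exact: (span_linear_subset e).1.
Qed.

(** Strong induction on the dimension. In the reducible case [span e] is the sum of the image [S1]
    of an invariant subspace [W] and its orthogonal complement [S2], both invariant and of smaller
    dimension, and [s] is decomposed accordingly. *)
Lemma intertwiner_stable n (e : 'I_n -> Cfun R K) :
  orthonormal_family ip e -> invariant_subset a (span e) ->
  forall s, span e s -> span e (E s).
Proof.
elim/ltn_ind: n e => n IH e eON einv s es.
have [irr|nirr] := pselect (irreducible (subrep eON einv)).
  exact: irreducible_stable irr s es.
(* [irreducible] excludes the zero space, which is treated apart before a subspace [W] is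
   extracted. *)
have [v0|v0] := pselect (exists v : euclidean R n, v != 0); last first.
  rewrite -(unembK eON es) (_ : unemb _ _ _ _ = 0).
    have := embP e (-1) 0 0; rewrite !scaleN1r !addNr => ->.
    by rewrite E0; exact: (span_linear_subset e).1.
  by apply/eqP; apply: contrapT => /negP v0'; apply: v0; eexists; exact: v0'.
have [W [Wc W0 WP Winv Wnt]] : exists W : set (euclidean R n),
    [/\ closed W, W 0, (forall c u v, W u -> W v -> W (c *: u + v)),
      (forall g v, W v -> W (subrep eON einv g v)) & ~ (W = [set 0] \/ W = setT)].
  apply: contrapT => H; apply: nirr; split=> // W Wc W0 WP Winv.
  by apply: contrapT => Wnt; apply: H; exists W.
pose S1 := emb e @` W.
have S1e : S1 `<=` span e by move=> _ [w _ <-]; exact: emb_span.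
have emb0 : emb e 0 = 0.
  by have := embP e (-1) 0 0; rewrite !scaleN1r !addNr.
have S1L : linear_subset S1.
  split; first by exists 0.
  move=> c _ _ [u Wu <-] [v Wv <-]; rewrite -embP.
  by exists (c *: u + v) => //; exact: WP.
have [m1 [f1 [m1n f1ON S1f]]] : exists m (f : 'I_m -> Cfun R K),
    [/\ (m < n)%N, orthonormal_family ip f & S1 = span f].
  apply: on_basis_proper S1L S1e _ => S1T; apply: Wnt; right.
  apply/seteqP; split=> // v _; have := emb_span e v; rewrite -S1T => -[w Ww wv].
  by rewrite -(embK eON v) -wv embK.
pose S2 : set (Cfun R K) := [set t | span e t /\ forall w, S1 w -> ip t w = 0].
have S2e : S2 `<=` span e by move=> t [].
have S2L : linear_subset S2.
  split.
    by split=> [|w _]; [exact: (span_linear_subset e).1|exact: linear0l].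
  move=> c u v [eu u0] [ev v1]; split; first exact: (span_linear_subset e).2.
  by move=> w Sw; rewrite dotDl dotZl u0// v1// mulr0 addr0.
have [m2 [f2 [m2n f2ON S2f]]] : exists m (f : 'I_m -> Cfun R K),
    [/\ (m < n)%N, orthonormal_family ip f & S2 = span f].
  (* If [S2] were all of [span e], each [emb e w] with [w] in [W] would be orthogonal to itself. *)
  apply: on_basis_proper S2L S2e _ => S2T; apply: Wnt; left.
  apply/seteqP; split=> [w Ww|w ->]//; rewrite -(embK eON w).
  suff -> : emb e w = 0 by rewrite -emb0 embK.
  have : S2 (emb e w) by rewrite S2T; exact: emb_span.
  move=> [_ /(_ (emb e w))] H; apply/eqP; rewrite -(dnorm_eq0 ip); apply/eqP.
  by apply: H; exists w.
have S1inv : invariant_subset a (span f1).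
  rewrite -S1f => g _ [w Ww <-]; exists (subrep eON einv g w); first exact: Winv.
  exact: emb_subrep.
have S2inv : invariant_subset a (span f2).
  rewrite -S2f => g t [et t0]; split; first exact: (einv g t et).
  move=> w; rewrite S1f L2dot_translateV => Sw; apply: t0; rewrite S1f.
  exact: S1inv.
pose p := \sum_(i < m1) ip s (f1 i) *: f1 i.
have Sp : span f1 p by exists (fun i => ip s (f1 i)).
have Sq : span f2 (s - p).
  rewrite -S2f; split.
    rewrite -scaleN1r addrC; apply: (span_linear_subset e).2 => //.
    by apply: S1e; rewrite S1f.
  move=> w; rewrite S1f => -[c ->]; rewrite dot_sumr big1// => i _.
  by rewrite dotZr on_residual ?mulr0.
rewrite -(subrK p s) -[s - p]scale1r EP.
apply: (span_linear_subset e).2.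
  by apply: S2e; rewrite S2f; exact: (IH m2).
by apply: S1e; rewrite S1f; exact: (IH m1).
Qed.

End Intertwiners.

(** * Multiplicity-free actions have accessible subspaces *)

Section MultiplicityFreeAccessible.
Variables (R : realType) (G : topologicalGroupType) (K : ptopologicalType).
Variables (a : transitive_action G K) (mu : probability (borel K) R) (x0 : K).
Hypotheses (compactG : compact [set: G]) (compactK : compact [set: K]).
Hypothesis invmu : invariant_measure a mu.
Local Notation ip := (L2dot compactK invmu).

Lemma L2inner_suml n (c : 'I_n -> Cplx R) (e : 'I_n -> Cfun R K)
    (f : borel K -> Cplx R) : L2fun mu f ->
  L2inner mu (\sum_(i < n) c i *: e i : Cfun R K) f =
  \sum_(i < n) c i * L2inner mu (e i) f.
Proof.
move=> f2.
have LP (b : Cplx R) (u v : Cfun R K) :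
    L2inner mu (b *: u + v : Cfun R K) f = b * L2inner mu u f + L2inner mu v f.
  exact: (L2innerPl b (Cfun_L2 mu compactK u) (Cfun_L2 mu compactK v) f2).
elim/big_rec2 : _ => [|i y z _ <-]; last exact: (LP (c i) (e i) z).
by have := LP (-1) 0 0; rewrite scaler0 addr0 mulN1r addNr.
Qed.

(** Stated with [L2inner] rather than [ip], since [accessible] asks for a projection defined on all
    of L2. *)
Definition span_projection n (e : 'I_n -> Cfun R K) (f : borel K -> Cplx R) :
  Cfun R K := \sum_(i < n) L2inner mu f (e i) *: e i.

Lemma span_projectionP n (e : 'I_n -> Cfun R K) : orthonormal_family ip e ->
  L2_orthogonal_projection mu (span e) (span_projection e).
Proof.
move=> eON f f2; have L2 := Cfun_L2 mu compactK.
split; first by exists (fun i => L2inner mu f (e i)).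
move=> s [c ->]; set s' := \sum_(i < n) _; set p := span_projection e f.
have -> : (fun x => f x - p x) = (fun x => (-1) * p x + f x).
  by apply/funext => x; rewrite mulN1r addrC.
rewrite L2innerPl// mulN1r addrC; apply/eqP; rewrite subr_eq0; apply/eqP.
rewrite L2innerC// [RHS]L2innerC//; congr (_^*).
rewrite L2inner_suml// -[RHS]/(ip s' p) dot_suml; apply: eq_bigr => i _.
by rewrite dotZl [ip (e i) p]dotC dot_sum_on// -L2innerC.
Qed.

(** The bound in [proj_bounded] is an arbitrary complex number; its modulus serves as a real
    constant. *)
Lemma equivariant_projection_bound (S : set (Cfun R K))
    (Q : {linear Cfun R K -> Cfun R K}) : equivariant_projection a S Q ->
  exists2 C : R, 0 <= C & forall (h : Cfun R K) (M : R),
    (forall x, nrm (h x) <= M) -> forall x, nrm (Q h x) <= C * M.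
Proof.
case=> _ _ [M QM] _; exists (nrm M); first exact: nrm_ge0.
move=> h c hc x.
have c0 : 0 <= c := le_trans (nrm_ge0 _) (hc x).
have H : `|Q h x| <= M * toC c.
  by apply: QM => y; rewrite -nrm_le.
rewrite nrm_le toCM -(ger0_norm c0) -toC_norm nrmE -normrM.
by rewrite ger0_norm// (le_trans _ H).
Qed.

(** The vector [h = f - p] is orthogonal to the subspace and [Q h = Q f - p]. With [s = Q h],
    [intertwiner_stable] puts [kernel_adjoint s] into the subspace, so [kernel_adjoint_estimate]
    makes [<Q h, Q h>] arbitrarily small. *)
Lemma multiplicity_free_accessible : multiplicity_free R a x0 ->
  forall S : set (Cfun R K), finite_dim_subspace S -> invariant_subset a S ->
    accessible a mu S.
Proof.
move=> MF S [n0 [e0 S0]] Sinv.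
have [n [e [_ eON Se]]] :=
  on_basis_span ip (span_linear_subset e0) (fun f : Cfun R K => id).
rewrite {}S0 Se in Sinv *.
have L2 := Cfun_L2 mu compactK.
have PO := span_projectionP eON.
exists (span_projection e) => // Q QE f.
have [C C0 QC] := equivariant_projection_bound QE.
set p := span_projection e f.
have [ep fp] := PO f (L2 f); pose h := f - p.
have hS s : span e s -> ip h s = 0 by exact: fp.
have Qh : Q h = Q f - p by rewrite linearB (proj_id QE ep).
apply/eqP; rewrite -subr_eq0 -/p -Qh.
rewrite -(dnorm_eq0 ip); apply/eqP/nrm0P/eqP; rewrite eq_le nrm_ge0 andbT.
have es := proj_range QE h; set s := Q h in es *.
have [Ms Ms0 sM] := Cfun_bounded s compactK.
apply/ler_addgt0Pr => r r0; rewrite add0r.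
have CM : 0 < C * Ms + 1 by rewrite ltr_wpDl// mulr_ge0.
(* This radius keeps the bound [C * Ms * e] below [r]; the added 1 makes the denominator
   positive. *)
apply: le_trans (@kernel_adjoint_estimate _ _ _ _ _ x0 compactG compactK invmu
  h Q C C0 QC _ s Ms (divr_gt0 r0 CM) Ms0 sM _) _.
  apply/hS; apply: (intertwiner_stable MF _ _ eON Sinv) es.
  - exact: kernel_adjointP.
  - by move=> g u; apply: kernel_adjoint_equivariant; exact: proj_equivariant QE.
by rewrite mulrCA ler_piMr ?(ltW r0)// ler_pdivrMr// mul1r lerDl.
Qed.

End MultiplicityFreeAccessible.

(** * Matrix coefficients *)

Section HilbertSpace.
Variables (R : realType) (V : hilbertSpace R).
Implicit Types v w : V.
Local Notation "''[' u , v ]" := (inner V u%R v%R) : ring_scope.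
Local Notation "''[' u ]" := '[u, u]%R : ring_scope.

Definition hnorm v : R := complex.Re `|v|.

Lemma hnormE v : toC (hnorm v) = `|v|.
Proof. by rewrite toC_Re. Qed.

Lemma hnorm_ge0 v : 0 <= hnorm v.
Proof. by rewrite -toC_ge0 hnormE normr_ge0. Qed.

Lemma hnorm_sq v : toC (hnorm v ^+ 2) = '[v].
Proof. by rewrite toCX hnormE inner_norm. Qed.

Lemma hnormZ c v : hnorm (c *: v) = nrm c * hnorm v.
Proof. by rewrite /hnorm normrZ -hnormE -nrmE -toCM. Qed.

Lemma inner_le v w : nrm '[v, w] <= hnorm v * hnorm w.
Proof.
rewrite nrm_le -(ler_pXn2r (n := 2)) ?nnegrE ?normr_ge0 ?toC_ge0 ?mulr_ge0 ?hnorm_ge0//.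
apply: le_trans (dot_cauchy_schwarz _ _ _) _.
by rewrite -!hnorm_sq -toCM -exprMn toCX.
Qed.

Lemma inner_continuous v : continuous (inner V v).
Proof.
move=> w; apply/cvgrPdist_lt => _ /lt_toC[e e0 ->].
have v1 : 0 < hnorm v + 1 by rewrite ltr_wpDl ?hnorm_ge0.
have ev : 0 < toC (e / (hnorm v + 1)) by rewrite (toC_lt 0) divr_gt0.
have /cvgrPdist_lt/(_ _ ev) := @cvg_id _ (nbhs w).
apply: filterS => w'; rewrite -hnormE toC_lt ltr_pdivlMr// => H.
rewrite -dotBr -nrm_lt; apply: le_lt_trans (inner_le _ _) _.
apply: le_lt_trans H; rewrite mulrC ler_wpM2l ?hnorm_ge0// lerDl//.
Qed.

Lemma inner_inj v w : (forall z, '[v, z] = '[w, z]) -> v = w.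
Proof.
move=> vw; apply/eqP; rewrite -subr_eq0 -(dnorm_eq0 (inner V)); apply/eqP.
by rewrite dotBl vw subrr.
Qed.

End HilbertSpace.

Section MatrixCoefficient.
Variables (R : realType) (G : topologicalGroupType) (K : ptopologicalType).
Variables (a : transitive_action G K) (x0 : K).
Hypotheses (compactG : compact [set: G]) (hausdorffK : hausdorff_space K).

Lemma orbit_continuous : continuous (fun g => a g x0).
Proof.
move=> g; apply: (@continuous_comp _ _ _ (fun g : G => (g, x0))
  (fun p : G * K => a p.1 p.2)); last exact: act_continuous.
by apply: cvg_pair; [exact: cvg_id | exact: cvg_cst].
Qed.

(* [K] carries the quotient topology of [G]: the orbit map is closed, since it
   goes from a compact space to a Hausdorff one. *)
Lemma orbit_quotient_continuous (T : topologicalType) (f : K -> T) :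
  continuous (fun g => f (a g x0)) -> continuous f.
Proof.
move=> /continuous_closedP fc; apply/continuous_closedP => A cA.
rewrite (_ : f @^-1` A = (fun g => a g x0) @` ((fun g => f (a g x0)) @^-1` A)).
  apply: compact_closed => //; apply: continuous_compact.
    exact/continuous_subspaceT/orbit_continuous.
  by apply: subclosed_compact compactG _ => //; exact: fc.
apply/seteqP; split=> [x Ax|_ [g Ag <-]]//.
by have [g gx] := act_transitive a x0 x; exists g => //=; rewrite gx.
Qed.

Definition transporter (x : K) : G := sval (cid (act_transitive a x0 x)).

Lemma transporterP x : a (transporter x) x0 = x.
Proof. exact: (svalP (cid (act_transitive a x0 x))). Qed.

Variables (V : hilbertSpace R) (pi : unitary_rep G V).
Local Notation fixed := (fixed_vectors pi (stabilizer a x0)).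

Lemma fixed_linear : linear_subset fixed.
Proof.
split=> [h _|c u v uf vf h hx]; first exact: linear0.
by rewrite linearP uf// vf.
Qed.

Lemma fixed_act u g h : fixed u -> a g x0 = a h x0 -> pi g u = pi h u.
Proof.
move=> uf gh; rewrite -(mulVKg h g) repM uf//.
by rewrite /stabilizer /= actM gh actK.
Qed.

(** The value at [a g x0] is meant to be [<v, pi g u>]; for fixed [u] the choice of [g] made by
    [transporter] does not matter ([coeff_fun_act]). *)
Definition coeff_fun (u v : V) (x : K) : Cplx R :=
  inner V v (pi (transporter x) u).

Lemma coeff_fun_act u v g : fixed u -> coeff_fun u v (a g x0) = inner V v (pi g u).
Proof.
by move=> uf; rewrite /coeff_fun (fixed_act uf (transporterP (a g x0))).
Qed.

Lemma coeff_continuous u v : fixed u -> continuous (coeff_fun u v).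
Proof.
move=> uf; apply: orbit_quotient_continuous.
rewrite (_ : (fun _ => _) = fun g => inner V v (pi g u)); last first.
  by apply/funext => g; exact: coeff_fun_act.
move=> g; apply: (@continuous_comp _ _ _ (fun g => pi g u) (inner V v)).
  exact: rep_continuous.
exact: inner_continuous.
Qed.

Definition coeff u (uf : fixed u) (v : V) : Cfun R K :=
  mkcts (@coeff_continuous u v uf).

Lemma coeffE u (uf : fixed u) v g : coeff uf v (a g x0) = inner V v (pi g u).
Proof. exact: coeff_fun_act. Qed.

Lemma Cfun_orbitP (f h : Cfun R K) : (forall g, f (a g x0) = h (a g x0)) -> f = h.
Proof. by move=> fh; apply: CfunP => x; rewrite -(transporterP x) fh. Qed.

Lemma coeffP u (uf : fixed u) c v w :
  coeff uf (c *: v + w) = c *: coeff uf v + coeff uf w.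
Proof.
by apply: Cfun_orbitP => g; rewrite CfunE !coeffE dotDl dotZl.
Qed.

Lemma coeff_conj u u' c (uf : fixed u) (uf' : fixed u') (wf : fixed (c *: u + u')) v :
  coeff wf v = c^* *: coeff uf v + coeff uf' v.
Proof.
by apply: Cfun_orbitP => g; rewrite CfunE !coeffE linearP dotDr dotZr.
Qed.

Lemma coeff_translate u (uf : fixed u) g v :
  coeff uf (pi g v) = translate a g (coeff uf v).
Proof.
apply: Cfun_orbitP => h; rewrite translateE -actM !coeffE.
by rewrite rep_adjoint -repM.
Qed.

Lemma rep_hnorm g v : hnorm (pi g v) = hnorm v.
Proof.
apply/eqP; rewrite -(eqrXn2 (n := 2)) ?hnorm_ge0//.
by apply/eqP/toC_inj; rewrite !hnorm_sq rep_unitary.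
Qed.

Lemma coeff_le u (uf : fixed u) v x : nrm (coeff uf v x) <= hnorm v * hnorm u.
Proof.
by rewrite -(transporterP x) coeffE -(rep_hnorm (transporter x) u) inner_le.
Qed.

End MatrixCoefficient.

(** The values lie in a compact segment, so the image of [U] has a cluster point there and, [U]
    being an ultrafilter, stays within [e / 2] of it. *)
Lemma ultra_bounded_cauchy (R : realType) (T : Type) (U : set_system T)
    (f : T -> R) (M e : R) : UltraFilter U -> U [set t | `|f t| <= M] -> 0 < e ->
  \forall p \near (U, U), `|f p.1 - f p.2| < e.
Proof.
move=> UU fM e0; have UP : ProperFilter U := @ultra_proper _ _ UU.
have FI : (f @ U) `[- M, M]%classic.
  suff : U [set t | f t \in `[- M, M]] by [].
  by apply: filterS fM => t /=; rewrite in_itv/= -ler_norml.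
have [p [_ /= pcl]] := @segment_compact R (- M) M (f @ U) _ FI.
have e2 : 0 < e / 2 by rewrite divr_gt0.
have Up : U [set t | `|p - f t| < e / 2].
  have [//|UC] := in_ultra_setVsetC [set t | `|p - f t| < e / 2] UU.
  have fUC : (f @ U) (~` ball p (e / 2)).
    suff : U [set t | ~ ball p (e / 2) (f t)] by [].
    by apply: filterS UC => t; rewrite /setC /= -ball_normE.
  by have [y []] := pcl _ _ fUC (nbhsx_ballx p _ e2).
exists ([set t | `|p - f t| < e / 2], [set t | `|p - f t| < e / 2]) => //.
move=> [s t] /= [ps pt]; rewrite -(subrKA p) (splitr e).
by apply: le_lt_trans (ler_normD _ _) _; rewrite ltrD// distrC.
Qed.

(** * Schur's lemma for the coefficient map, by maximizing its norm *)

Section Schur.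
Variables (R : realType) (G : topologicalGroupType) (K : ptopologicalType).
Variables (a : transitive_action G K) (mu : probability (borel K) R) (x0 : K).
Hypotheses (compactG : compact [set: G]) (hausdorffK : hausdorff_space K).
Hypotheses (compactK : compact [set: K]) (invmu : invariant_measure a mu).
Local Notation ip := (L2dot compactK invmu).
Variables (V : hilbertSpace R) (pi : unitary_rep G V).
Hypothesis irr : irreducible pi.
Local Notation fixed := (fixed_vectors pi (stabilizer a x0)).
Variables (u : V) (uf : fixed u).
Local Notation T := (coeff compactG hausdorffK uf).
Implicit Types v w : V.

Definition qform v : R := complex.Re (ip (T v) (T v)).

Lemma qformE v : toC (qform v) = ip (T v) (T v).
Proof. by rewrite toC_Re// dnorm_ge0. Qed.

Lemma qform_ge0 v : 0 <= qform v.
Proof. by rewrite -toC_ge0 qformE dnorm_ge0. Qed.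

Lemma coeffD v w : T (v + w) = T v + T w.
Proof. by rewrite -[v]scale1r coeffP !scale1r. Qed.

Lemma coeffB v w : T (v - w) = T v - T w.
Proof. by rewrite -scaleN1r addrC coeffP scaleN1r addrC. Qed.

Lemma qformZ c v : qform (c *: v) = nrm c ^+ 2 * qform v.
Proof.
apply: toC_inj; rewrite toCM toCX nrmE !qformE.
have -> : T (c *: v) = c *: T v.
  by rewrite -[c *: v]addr0 -{1}(subrr v) coeffP coeffB subrr addr0.
exact: dnormZ.
Qed.

Lemma qform_parallelogram v w :
  qform (v + w) + qform (v - w) = 2 * qform v + 2 * qform w.
Proof.
apply: toC_inj; rewrite !toCD !toCM !qformE toC_nat.
by rewrite coeffD coeffB dot_parallelogram.
Qed.

Lemma hnorm_parallelogram v w :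
  hnorm (v + w) ^+ 2 + hnorm (v - w) ^+ 2 = 2 * hnorm v ^+ 2 + 2 * hnorm w ^+ 2.
Proof.
apply: toC_inj.
by rewrite !toCD !(toCM 2) !hnorm_sq toC_nat dot_parallelogram.
Qed.

Lemma qform_rep g v : qform (pi g v) = qform v.
Proof. by rewrite /qform coeff_translate L2dot_translate. Qed.

Lemma qform_le v (c : R) : 0 <= c -> (forall x, nrm (T v x) <= c) ->
  qform v <= c ^+ 2.
Proof.
move=> c0 Tc; apply: le_trans (ler_norm _) _; apply: le_trans (Re_le_nrm _) _.
by rewrite expr2; exact: L2dot_le.
Qed.

Lemma qform_le_hnorm v : qform v <= (hnorm v * hnorm u) ^+ 2.
Proof.
apply: qform_le; first by rewrite mulr_ge0 ?hnorm_ge0.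
by move=> x; exact: coeff_le.
Qed.

Lemma qform_gt0 : u != 0 -> 0 < qform u.
Proof.
move=> u0; rewrite -(toC_lt 0) qformE; apply: (@L2inner_gt0 _ _ _ a) => //.
apply/eqP => /(congr1 (fun f : Cfun R K => f (a 1%g x0))).
rewrite coeffE rep1 => /eqP; rewrite dnorm_eq0; exact/negP.
Qed.

(* By irreducibility [qform] equals its maximum on the unit sphere times the
   squared norm: the maximum is attained because the coefficient map is compact,
   and the maximizers form a closed invariant subspace. *)
Definition qmax : R := sup [set qform v | v in [set v | hnorm v = 1]].

Let sphere_neq0 : exists v : V, hnorm v = 1.
Proof.
have [[v v0] _] := irr; exists (toC (hnorm v)^-1 *: v).
have v1 : hnorm v != 0.
  by apply: contra_neq v0 => v0; apply/normr0_eq0; rewrite -hnormE v0.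
by rewrite hnormZ nrm_toC ger0_norm ?invr_ge0 ?hnorm_ge0// mulVf.
Qed.

Let qmax_has_sup : has_sup [set qform v | v in [set v | hnorm v = 1]].
Proof.
split; first by have [v v1] := sphere_neq0; exists (qform v); exists v.
exists (hnorm u ^+ 2) => _ [v v1 <-].
by apply: le_trans (qform_le_hnorm v) _; rewrite v1 mul1r.
Qed.

Lemma qform_le_qmax v : qform v <= qmax * hnorm v ^+ 2.
Proof.
have [v0|v0] := eqVneq (hnorm v) 0.
  by apply: le_trans (qform_le_hnorm v) _; rewrite v0 mul0r expr0n mulr0.
pose w := toC (hnorm v)^-1 *: v.
have hv : nrm (toC (hnorm v)^-1) = (hnorm v)^-1.
  by rewrite nrm_toC ger0_norm ?invr_ge0 ?hnorm_ge0.
have w1 : hnorm w = 1 by rewrite hnormZ hv mulVf.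
have : qform w <= qmax by apply: sup_upper_bound => //; exists w.
rewrite qformZ hv exprVn mulrC ler_pdivrMr//.
by rewrite exprn_gt0// lt_neqAle eq_sym v0 hnorm_ge0.
Qed.

(** A nonnegative quadratic form whose null vectors are 0 and the multiples of the maximizers of
    [qform] on the unit sphere. *)
Definition defect v : R := qmax * hnorm v ^+ 2 - qform v.

Lemma defect_ge0 v : 0 <= defect v.
Proof. by rewrite subr_ge0 qform_le_qmax. Qed.

Lemma defectZ c v : defect (c *: v) = nrm c ^+ 2 * defect v.
Proof. by rewrite /defect hnormZ qformZ; ring. Qed.

Lemma defect_rep g v : defect (pi g v) = defect v.
Proof. by rewrite /defect rep_hnorm qform_rep. Qed.

(** The parallelogram law with a nonnegative term dropped; in particular null vectors of [defect]
    are closed under addition. *)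
Lemma defectD v w : defect (v + w) <= 2 * defect v + 2 * defect w.
Proof.
have H : defect (v + w) + defect (v - w) = 2 * defect v + 2 * defect w.
  transitivity (qmax * (hnorm (v + w) ^+ 2 + hnorm (v - w) ^+ 2) -
                (qform (v + w) + qform (v - w))); first by rewrite /defect; ring.
  by rewrite hnorm_parallelogram qform_parallelogram /defect; ring.
by rewrite -H lerDl defect_ge0.
Qed.

Lemma defectB v w : defect (v - w) <= 2 * defect v + 2 * defect w.
Proof.
apply: le_trans (defectD _ _) _; rewrite -scaleN1r defectZ.
by rewrite -[-1]/(- 1 : Cplx R) /nrm normrN1 /= expr1n mul1r.
Qed.

Lemma defect_le v : defect v <= qmax * hnorm v ^+ 2.
Proof. by rewrite gerBl qform_ge0. Qed.

Lemma defect_near v w (e : R) : 0 <= qmax -> hnorm (v - w) < e ->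
  defect v <= 2 * defect w + 2 * (qmax * e ^+ 2).
Proof.
move=> q0 vw; rewrite -{1}(subrK w v) addrC.
apply: le_trans (defectD _ _) _; rewrite lerD2l ler_wpM2l//.
apply: le_trans (defect_le _) _; apply: ler_wpM2l => //.
by rewrite ler_sqr ?nnegrE ?hnorm_ge0 ?(le_trans (hnorm_ge0 (v - w)) (ltW vw)) ?ltW.
Qed.

Hypothesis u0 : u != 0.

Lemma qmax_gt0 : 0 < qmax.
Proof.
have := lt_le_trans (qform_gt0 u0) (qform_le_qmax u).
have [->|/eqP u1] := eqVneq (hnorm u ^+ 2) 0; first by rewrite mulr0 ltxx.
rewrite pmulr_lgt0// lt_neqAle eq_sym sqr_ge0 andbT; exact/eqP.
Qed.

(** Unit vectors at which [qform] is close to its supremum; the limit of a convergent refinement of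
    this filter is a maximizer. *)
Definition maximizing : set_system V :=
  filter_from [set e : R | 0 < e] (fun e => [set v | hnorm v = 1 /\ defect v < e]).

Lemma maximizing_filter : ProperFilter maximizing.
Proof.
apply: filter_from_proper.
  apply: filter_from_filter; first by exists 1 => /=; exact: ltr01.
  move=> e1 e2 /= e10 e20; exists (Num.min e1 e2); first by rewrite /= lt_min e10.
  by move=> v [v1]; rewrite lt_min => /andP[].
move=> e /= e0.
have [_ [v v1 <-] qv] := sup_adherent e0 qmax_has_sup.
by exists v; split=> //; rewrite /defect v1 expr1n mulr1 ltrBlDr -ltrBlDl.
Qed.

(* The orbit of [u] being compact, convergence of [<v, pi g u>] along an
   ultrafilter for each [g] is uniform in [g]. *)
Lemma maximizing_uniform (U : set_system V) (e : R) : UltraFilter U ->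
  maximizing `<=` U -> 0 < e ->
  \forall p \near (U, U), forall x, nrm (T (p.1 - p.2) x) <= e.
Proof.
move=> UU MU e0.
have /compact_near_coveringP cG := compactG.
have U1 : U [set v | hnorm v = 1].
  by apply: MU; exists 1 => /=; [exact: ltr01 | move=> v []].
have e4 : 0 < e / 4 by rewrite divr_gt0.
suff : \forall p \near (U, U), [set: G] `<=`
    (fun g => nrm (inner V (p.1 - p.2) (pi g u)) <= e).
  apply: filterS => p H x; rewrite -(transporterP a x0 x) coeffE; exact: H.
have UP : ProperFilter U := @ultra_proper _ _ UU.
apply: (cG (V * V)%type (filter_prod U U)
  (fun p g => nrm (inner V (p.1 - p.2) (pi g u)) <= e)) => g _.
set w := pi g u.
have Uw (part : Cplx R -> R) : (forall z, `|part z| <= nrm z) ->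
    \forall p \near (U, U), `|part (inner V p.1 w) - part (inner V p.2 w)| < e / 4.
  move=> part_le; apply: (@ultra_bounded_cauchy _ _ U
    (fun v => part (inner V v w)) (hnorm w)) => //.
  apply: filterS U1 => v v1 /=; apply: le_trans (part_le _) _.
  by rewrite -[leRHS]mul1r -v1 inner_le.
have wnear : \forall g' \near g, hnorm (w - pi g' u) < e / 4.
  have /cvgrPdist_lt/(_ (toC (e / 4))) := @rep_continuous _ _ _ pi u g.
  rewrite toC_lt => /(_ e4); apply: filterS => g'.
  by rewrite -hnormE toC_lt.
have U11 : \forall p \near (U, U), hnorm p.1 = 1 /\ hnorm p.2 = 1.
  by exists ([set v | hnorm v = 1], [set v | hnorm v = 1]) => //= -[p q] [].
exists ([set g' | hnorm (w - pi g' u) < e / 4], [set p : V * V |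
  (`|complex.Re (inner V p.1 w) - complex.Re (inner V p.2 w)| < e / 4 /\
  `|complex.Im (inner V p.1 w) - complex.Im (inner V p.2 w)| < e / 4) /\
  (hnorm p.1 = 1 /\ hnorm p.2 = 1)]).
  split=> //=; apply: filterI => //; apply: filterI.
    exact: Uw (@Re_le_nrm R).
  exact: Uw (@Im_le_nrm R).
move=> [g' p] /= [wg' [[re im] [p1 p2]]].
(* Replacing [pi g' u] by [w] costs at most [2 * (e / 4)], as [p.1 - p.2] has norm at most 2; the
   real and imaginary parts at [w] cost [e / 4] each. *)
have -> : inner V (p.1 - p.2) (pi g' u) =
    inner V (p.1 - p.2) w - inner V (p.1 - p.2) (w - pi g' u).
  by rewrite dotBr subKr.
apply: le_trans (nrmD _ _) _; rewrite -[- inner _ _ _]sub0r nrmB subr0.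
have H1 : nrm (inner V (p.1 - p.2) w) <= e / 4 + e / 4.
  apply: le_trans (nrm_le_ReIm _) _; rewrite dotBl cReB cImB.
  by rewrite lerD// ltW.
have H2 : nrm (inner V (p.1 - p.2) (w - pi g' u)) <= 2 * (e / 4).
  apply: le_trans (inner_le _ _) _; apply: ler_pM; rewrite ?hnorm_ge0 ?(ltW wg')//.
  rewrite -toC_le hnormE; apply: le_trans (ler_normB _ _) _.
  by rewrite -!hnormE p1 p2 -toCD.
by apply: le_trans (lerD H1 H2) _; lra.
Qed.

(** The squared norm of [v - w] times [qmax] is [defect (v - w) + qform (v - w)]. The first term is
    at most half of [qmax * e ^+ 2] by [defectB], the second at most a quarter by
    [maximizing_uniform]. *)
Lemma maximizing_cauchy (U : set_system V) : UltraFilter U ->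
  maximizing `<=` U -> cauchy U.
Proof.
move=> UU MU; have UP : ProperFilter U := @ultra_proper _ _ UU.
have q0 := qmax_gt0.
apply/cauchy_ballP => _ /lt_toC[e e0 ->].
have ep : 0 < e * Num.sqrt qmax / 2.
  by rewrite divr_gt0// mulr_gt0// sqrtr_gt0.
have eta0 : 0 < qmax * e ^+ 2 / 8 by rewrite divr_gt0// mulr_gt0// exprn_gt0.
have Ud : U [set v | defect v < qmax * e ^+ 2 / 8].
  by apply: MU; exists (qmax * e ^+ 2 / 8) => // v [].
have Up : \forall p \near (U, U), defect p.1 < qmax * e ^+ 2 / 8 /\
    defect p.2 < qmax * e ^+ 2 / 8.
  by exists ([set v | defect v < qmax * e ^+ 2 / 8],
    [set v | defect v < qmax * e ^+ 2 / 8]) => //= -[p q] [].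
apply: filterS (filterI Up (maximizing_uniform UU MU ep)) => -[v w] /= [[dv dw] vw].
rewrite -ball_normE /= -hnormE toC_lt.
have := qform_le (ltW ep) vw; rewrite exprMn exprVn exprMn sqr_sqrtr ?(ltW q0)// => qvw.
rewrite -ltr_sqr ?nnegrE ?hnorm_ge0 ?(ltW e0)// -(ltr_pM2l q0).
have : qmax * hnorm (v - w) ^+ 2 = defect (v - w) + qform (v - w).
  by rewrite /defect subrK.
have := defectB v w => H ->; nra.
Qed.

Lemma qform_scalar v : qform v = qmax * hnorm v ^+ 2.
Proof.
have q0 := qmax_gt0.
(* An ultrafilter finer than [maximizing] is Cauchy, and completeness of [V] supplies its limit
   [z]. *)
have [U [UU MU]] := ultraFilterLemma maximizing_filter.
have UP : ProperFilter U := @ultra_proper _ _ UU.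
have /cvg_ex[z Uz] : cvg U by apply/cauchy_cvgP; exact: maximizing_cauchy.
have near_z e : 0 < e -> exists v, [/\ hnorm v = 1, defect v < e & hnorm (z - v) < e].
  move=> e0; have Um : U [set v | hnorm v = 1 /\ defect v < e].
    by apply: MU; exists e.
  have eC : 0 < toC e by rewrite (toC_lt 0).
  have /cvgrPdist_lt/(_ _ eC) Uz' := Uz.
  have [w [[w1 wd] wz]] := filter_ex (filterI Um Uz').
  by exists w; split=> //; rewrite -toC_lt hnormE.
have defect0 w : (forall e, 0 < e -> exists v, [/\ defect v < e & hnorm (w - v) < e]) ->
    defect w = 0.
  move=> H; apply/eqP; rewrite eq_le defect_ge0 andbT.
  apply/ler_addgt0Pr => r r0; rewrite add0r.
  have c0 : 0 < 2 + 2 * qmax by rewrite addr_gt0// mulr_gt0.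
  (* Chosen so that [2 * t + 2 * (qmax * t ^+ 2) <= r], where [t <= 1] absorbs the square. *)
  pose t := Num.min 1 (r / (2 + 2 * qmax)).
  have t0 : 0 < t by rewrite lt_min ltr01/= divr_gt0.
  have t1 : t <= 1 by rewrite ge_min lexx.
  have tr : (2 + 2 * qmax) * t <= r.
    by rewrite mulrC -ler_pdivlMr// ge_min lexx orbT.
  have [x [dx wx]] := H _ t0.
  apply: le_trans (defect_near (ltW q0) wx) _; apply: le_trans tr.
  have : t ^+ 2 <= t by rewrite expr2 ler_piMr// ltW.
  by move/(ler_wpM2l (ltW q0)); lra.
have z0 : z != 0.
  have [x [x1 _ zx]] := near_z 1 ltr01.
  apply: contraTneq zx => ->; rewrite -leNgt -x1.
  by rewrite -toC_le !hnormE sub0r normrN.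
have dz : defect z = 0.
  by apply: defect0 => e e0; have [x [_ dx zx]] := near_z _ e0; exists x.
have defectD0 x y : defect x = 0 -> defect y = 0 -> defect (x + y) = 0.
  move=> dx dy; apply/eqP; rewrite eq_le defect_ge0 andbT.
  by apply: le_trans (defectD _ _) _; rewrite dx dy !mulr0 addr0.
(* The null vectors of [defect] form a closed invariant subspace containing the nonzero [z], hence
   all of [V]. *)
have [_ /(_ [set x | defect x = 0])] := irr.
case=> [|||g x /= dx|W0|WT].
- move=> x clx; apply: defect0 => e e0.
  have eC : 0 < toC e by rewrite (toC_lt 0).
  have [y [/= dy xy]] := clx _ (nbhsx_ballx x _ eC).
  exists y; rewrite dy; split=> //.
  by move: xy; rewrite -ball_normE /= -hnormE toC_lt.
- by have := defectZ 0 0; rewrite scale0r /nrm normr0 expr0n mul0r.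
- by move=> c x y /= dx dy; apply: defectD0 => //; rewrite defectZ dx mulr0.
- by rewrite defect_rep.
- have : [set x | defect x = 0] z by exact: dz.
  by rewrite W0 => /= zz; rewrite zz eqxx in z0.
have : [set x | defect x = 0] v by rewrite WT.
by move=> /eqP; rewrite subr_eq0 => /eqP.
Qed.

(* The trace of the form [qform] is at most the squared norm of [u]. *)
Lemma orthonormal_size_le n (e : 'I_n -> V) : orthonormal_family (inner V) e ->
  n%:R * qmax <= hnorm u ^+ 2.
Proof.
(* Pairing with the constant 1 turns integrals into inner products, to which [L2dot_le] applies. *)
move=> eON; pose one : Cfun R K := mkcts (@cst_continuous _ _ (1 : Cplx R)).
have bc i : continuous (fun x => nrm (T (e i) x) ^+ 2).
  have nc := continuous_nrm (@cts_fun _ _ (T (e i))).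
  by move=> y; apply: (cvgM (nc y) (nc y)).
pose b i : Cfun R K := mkcts (continuous_toC (bc i)).
have bE i : ip (b i) one = toC qmax.
  rewrite [LHS](@L2inner_real _ _ _ _ _ (fun x => nrm (T (e i) x) ^+ 2)); last first.
    by move=> x; rewrite conjC1 mulr1.
  rewrite -(@L2inner_real _ _ _ (T (e i)) (T (e i))); last first.
    by move=> x; rewrite toCX nrmE normCK.
  rewrite -[LHS]qformE qform_scalar; congr toC.
  have -> : hnorm (e i) ^+ 2 = 1 by apply: toC_inj; rewrite hnorm_sq eON eqxx.
  exact: mulr1.
have sumE : ip (\sum_(i < n) b i) one = toC (n%:R * qmax).
  rewrite dot_suml (eq_bigr (fun=> toC qmax)) => [|i _]; last exact: bE.
  by rewrite sumr_const card_ord -[LHS]mulr_natl toCM toC_nat.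
(* Bessel's inequality for [pi g u], whose norm is that of [u]. *)
have sum_le x : nrm ((\sum_(i < n) b i) x) <= hnorm u ^+ 2.
  rewrite -(transporterP a x0 x) Cfun_sumE; set g := transporter _ _ _.
  have -> : \sum_(i < n) b i (a g x0) =
      toC (\sum_(i < n) nrm (inner V (pi g u) (e i)) ^+ 2).
    rewrite toC_sum; apply: eq_bigr => i _.
    rewrite -[LHS]/(toC (nrm (T (e i) (a g x0)) ^+ 2)) coeffE.
    by rewrite (dotC _ (e i)) nrmJ.
  rewrite nrm_toC ger0_norm ?sumr_ge0// => [|i _]; last exact: sqr_ge0.
  rewrite -(rep_hnorm pi g u) -toC_le toC_sum hnorm_sq.
  under eq_bigr do rewrite toCX nrmE.
  exact: bessel.
have one_le x : nrm (one x) <= 1 by rewrite -[one x]/(toC 1) nrm_toC normr1.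
have := L2dot_le compactK invmu (sqr_ge0 _) sum_le one_le.
rewrite sumE nrm_toC mulr1; apply: le_trans; exact: ler_norm.
Qed.

End Schur.

(** Expanding [D] on the diagonal at [v + w] and at ['i *: v + w] gives the vanishing of the sum and
    of the difference of [D v w] and [D w v]. *)
Lemma hermitian_polarization (R : realType) (V : lmodType (Cplx R))
    (D : V -> V -> Cplx R) :
  (forall c u v w, D (c *: u + v) w = c * D u w + D v w) ->
  (forall c u v w, D w (c *: u + v) = c^* * D w u + D w v) ->
  (forall v, D v v = 0) -> forall v w, D v w = 0.
Proof.
move=> DL DR D0 v w.
have H1 : D v w + D w v = 0.
  have := D0 (1 *: v + w); rewrite DL !DR !D0 conjC1.
  by rewrite !mul1r addr0 add0r.
have H2 : D v w - D w v = 0.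
  have := D0 ('i *: v + w); rewrite DL !DR !D0 conjCi mulr0 add0r addr0.
  by rewrite mulNr -mulrBr => /eqP; rewrite mulf_eq0 (negbTE (neq0Ci _)) => /eqP.
have : 2 * D v w = 0.
  by rewrite -[RHS]addr0 -{1}H1 -H2; ring.
by move=> /eqP; rewrite mulf_eq0 pnatr_eq0 => /eqP.
Qed.

(** * Accessible subspaces force multiplicity-freeness *)

Section AccessibleMultiplicityFree.
Variables (R : realType) (G : topologicalGroupType) (K : ptopologicalType).
Variables (a : transitive_action G K) (mu : probability (borel K) R) (x0 : K).
Hypotheses (compactG : compact [set: G]) (hausdorffK : hausdorff_space K).
Hypotheses (compactK : compact [set: K]) (invmu : invariant_measure a mu).
Local Notation ip := (L2dot compactK invmu).
Variables (V : hilbertSpace R) (pi : unitary_rep G V).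
Hypothesis irr : irreducible pi.
Local Notation fixed := (fixed_vectors pi (stabilizer a x0)).
Local Notation coeff := (coeff compactG hausdorffK).

Lemma coeff_norm_scalar u (uf : fixed u) :
  exists l : Cplx R, forall v, ip (coeff uf v) (coeff uf v) = l * inner V v v.
Proof.
have [u0|u0] := eqVneq u 0.
  exists 0 => v; rewrite mul0r.
  suff -> : coeff uf v = 0 by exact: linear0l.
  by apply: (Cfun_orbitP (a := a) (x0 := x0)) => g; rewrite coeffE u0 linear0 linear0r.
exists (toC (qmax compactG hausdorffK compactK invmu uf)) => v.
by rewrite -hnorm_sq -toCM -qform_scalar// qformE.
Qed.

(** Polarization twice: the scalars of [u], [u'], [u + u'] and ['i *: u + u'] determine the form at
    [v = w], and [hermitian_polarization] extends the identity to all [v] and [w]. *)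
Lemma coeff_schur u u' (uf : fixed u) (uf' : fixed u') :
  exists c : Cplx R, forall v w, ip (coeff uf v) (coeff uf' w) = c * inner V v w.
Proof.
have [l lE] := coeff_norm_scalar uf; have [l' lE'] := coeff_norm_scalar uf'.
have wf c : fixed (c *: u + u') by exact: (fixed_linear a x0 pi).2.
have [m mE] := coeff_norm_scalar (wf 1); have [k kE] := coeff_norm_scalar (wf 'i).
(* With [z] and [n] as below, the sum of [z] and its conjugate is [(m - l - l') * n] and their
   difference is ['i * ((k - l - l') * n)]; adding gives [2 * z]. *)
pose c := ((m - l - l') + 'i * (k - l - l')) / 2.
have diag v : ip (coeff uf v) (coeff uf' v) = c * inner V v v.
  set z := ip (coeff uf v) (coeff uf' v); set n := inner V v v.
  have ii : 'i * 'i = -1 :> Cplx R by rewrite -expr2 sqrCi.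
  have z1 : z + z^* = (m - l - l') * n.
    rewrite !mulrBl -mE -lE -lE' (coeff_conj _ _ uf uf') conjC1 scale1r.
    by rewrite dotDl !dotDr -/z [ip (coeff uf' v) _]dotC -/z; ring.
  have z2 : - 'i * z + 'i * z^* = (k - l - l') * n.
    rewrite !mulrBl -kE -lE -lE' (coeff_conj _ _ uf uf') conjCi.
    rewrite dotDl !dotDr !dotZl !dotZr -/z [ip (coeff uf' v) _]dotC -/z.
    by rewrite rmorphN/= conjCi opprK; ring: ii.
  have i2 : 'i * ((k - l - l') * n) = z - z^*.
    by rewrite -z2; ring: ii.
  have : 2 * z = ((m - l - l') * n) + 'i * ((k - l - l') * n).
    by rewrite i2 -z1; ring.
  move=> H; apply: (mulfI (x := 2)); first by rewrite pnatr_eq0.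
  by rewrite H /c; field.
exists c => v w; apply/eqP; rewrite -subr_eq0; apply/eqP.
apply: (hermitian_polarization (D := fun v w =>
  ip (coeff uf v) (coeff uf' w) - c * inner V v w)) => [b x y t|b x y t|x].
- by rewrite coeffP !dotDl !dotZl; ring.
- by rewrite coeffP !dotDr !dotZr; ring.
- by rewrite diag subrr.
Qed.

(** At [v = w = u] the left side is [qform u], which is positive. *)
Lemma coeff_schur_neq0 u (uf : fixed u) c : u != 0 ->
  (forall v w, ip (coeff uf v) (coeff uf w) = c * inner V v w) -> c != 0.
Proof.
move=> u0 cE; have := qform_gt0 compactG hausdorffK compactK invmu uf u0.
rewrite -(toC_lt 0) qformE cE; apply: contraTneq => ->.
by rewrite mul0r ltxx.
Qed.

Lemma coeff_inj u (uf : fixed u) : u != 0 -> injective (coeff uf).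
Proof.
move=> u0 v w vw; have [c cE] := coeff_schur uf uf.
have c0 := coeff_schur_neq0 u0 cE.
apply/eqP; rewrite -subr_eq0 -(dnorm_eq0 (inner V)) -(mulrI_eq0 _ (mulfI c0)) -cE.
by rewrite coeffB vw subrr linear0l.
Qed.

(** [orthonormal_size_le] bounds the length of orthonormal families by [hnorm u ^+ 2 / q], so a
    maximal one exists and spans. *)
Lemma hilbert_finite u (uf : fixed u) : u != 0 ->
  exists n (e : 'I_n -> V), orthonormal_family (inner V) e /\ setT = span e.
Proof.
move=> u0; pose q := qmax compactG hausdorffK compactK invmu uf.
have q0 : 0 < q by exact: qmax_gt0.
have [||n [e [_ eON eV]]] := @on_basis R V (inner V) setT
  (Num.bound (hnorm u ^+ 2 / q)); last by exists n, e.
- by split.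
- move=> n e eON _; have := orthonormal_size_le compactG hausdorffK compactK invmu irr uf u0 eON.
  rewrite -ler_pdivlMr// => nq; rewrite -(ler_nat R); apply: le_trans nq _.
  exact/ltW/archi_boundP/divr_ge0/ltW/q0/sqr_ge0.
Qed.

Section Projection.
Variables (n : nat) (e : 'I_n -> V).
Hypotheses (eON : orthonormal_family (inner V) e) (eV : setT = span e).
Variables (u u' : V) (uf : fixed u) (uf' : fixed u').
Hypothesis uu' : forall v w, ip (coeff uf v) (coeff uf' w) = inner V v w.

(** The adjoint of the coefficient map of [u'], expanded in the basis [e]. *)
Definition coeff_adjoint (f : Cfun R K) : V :=
  \sum_(i < n) ip f (coeff uf' (e i)) *: e i.

Lemma coeff_sum u1 (u1f : fixed u1) (c : 'I_n -> Cplx R) :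
  coeff u1f (\sum_(i < n) c i *: e i) = \sum_(i < n) c i *: coeff u1f (e i).
Proof.
elim/big_rec2 : _ => [|i y1 y2 _ <-]; last exact: coeffP.
by have := coeffP compactG hausdorffK u1f (-1) 0 0; rewrite !scaleN1r !addNr.
Qed.

Lemma coeff_adjointE f w : inner V (coeff_adjoint f) w = ip f (coeff uf' w).
Proof.
have we : span e w by rewrite -eV.
rewrite {2}(on_coord eON we) coeff_sum dot_sumr /coeff_adjoint dot_suml.
by apply: eq_bigr => i _; rewrite dotZl dotZr mulrC [inner V (e i) w]dotC.
Qed.

(** By [uu'] the adjoint for [u'] is a left inverse of the coefficient map of [u], so this composite
    is a projection onto the range of the latter. *)
Definition coeff_projection_fun (f : Cfun R K) : Cfun R K :=
  coeff uf (coeff_adjoint f).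

Lemma coeff_adjointP c f h :
  coeff_adjoint (c *: f + h) = c *: coeff_adjoint f + coeff_adjoint h.
Proof.
by apply: inner_inj => w; rewrite dotDl dotZl !coeff_adjointE dotDl dotZl.
Qed.

Lemma coeff_projection_linear : linear coeff_projection_fun.
Proof.
by move=> c f h; rewrite /coeff_projection_fun coeff_adjointP coeffP.
Qed.

Definition coeff_projection : {linear Cfun R K -> Cfun R K} :=
  HB.pack coeff_projection_fun
    (GRing.isLinear.Build _ _ _ _ coeff_projection_fun coeff_projection_linear).

Lemma coeff_projectionE f : coeff_projection f = coeff uf (coeff_adjoint f).
Proof. by []. Qed.

Lemma coeff_span : coeff uf @` setT = span (fun i => coeff uf (e i)).
Proof.
apply/seteqP; split=> [_ [v _ <-]|_ [c ->]].
  have ve : span e v by rewrite -eV.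
  by rewrite (on_coord eON ve) coeff_sum; exists (fun i => inner V v (e i)).
by exists (\sum_(i < n) c i *: e i) => //; rewrite coeff_sum.
Qed.

Lemma coeff_projectionP :
  equivariant_projection a (coeff uf @` setT) coeff_projection.
Proof.
split.
- by move=> f; exists (coeff_adjoint f).
- move=> _ [v _ <-]; rewrite !coeff_projectionE; congr (coeff uf _).
  by apply: inner_inj => w; rewrite coeff_adjointE uu'.
- have [A A0 AE] := Cfun_bounded_family (fun i => coeff uf (e i)) compactK.
  have [B B0 BE] := Cfun_bounded_family (fun i => coeff uf' (e i)) compactK.
  exists (toC (\sum_(i < n) B * A)) => f c fc x.
  have c0 : 0 <= c := le_trans (normr_ge0 _) (fc x0).
  rewrite -(toC_Re c0) -toCM -nrm_le.
  have fc' y : nrm (f y) <= complex.Re c by rewrite nrm_le toC_Re.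
  rewrite coeff_projectionE /coeff_adjoint coeff_sum Cfun_sumE.
  apply: le_trans (nrm_sum _) _; rewrite mulr_suml; apply: ler_sum => i _.
  rewrite CfunZE nrmM mulrAC; apply: ler_pM; rewrite ?nrm_ge0//.
  rewrite mulrC; apply: L2dot_le => //; exact: le_trans (nrm_ge0 _) (fc' x0).
move=> g f; rewrite !coeff_projectionE -coeff_translate; congr (coeff uf _).
apply: inner_inj => w; rewrite coeff_adjointE rep_adjoint coeff_adjointE.
by rewrite coeff_translate L2dot_translateV.
Qed.

End Projection.

(* Otherwise [u1] has an independent fixed vector [b *: u1 + u2] whose
   coefficients are orthogonal to those of [u1]; perturbing the orthogonal
   projection onto the coefficients of [u1] by it gives another equivariant
   projection. *)
Lemma accessible_fixed_dependent :
  (forall S : set (Cfun R K), finite_dim_subspace S -> invariant_subset a S ->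
    accessible a mu S) ->
  forall u1 u2, fixed u1 -> fixed u2 ->
    exists c1 c2 : Cplx R, (c1 != 0) || (c2 != 0) /\ c1 *: u1 + c2 *: u2 = 0.
Proof.
move=> acc u1 u2 uf1 uf2.
have [u10|u10] := eqVneq u1 0.
  by exists 1, 0; rewrite oner_eq0/= u10 scaler0 scale0r addr0.
have [n [e [eON eV]]] := hilbert_finite uf1 u10.
have [c11 c11E] := coeff_schur uf1 uf1; have [c12 c12E] := coeff_schur uf1 uf2.
have c11_0 := coeff_schur_neq0 u10 c11E.
have fixP c u v : fixed u -> fixed v -> fixed (c *: u + v).
  exact: (fixed_linear a x0 pi).2.
(* Gram-Schmidt for the form on fixed vectors: [b * c11 + c12 = 0]. *)
pose b := - c12 / c11.
have uf3 : fixed (b *: u1 + u2) by exact: fixP.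
have T13 v w : ip (coeff uf1 v) (coeff uf3 w) = 0.
  rewrite (coeff_conj _ _ uf1 uf2) dotDr dotZr c11E c12E conjCK.
  by rewrite /b; field.
have [u30|u30] := eqVneq (b *: u1 + u2) 0.
  by exists b, 1; rewrite oner_eq0 orbT scale1r.
exfalso.
(* Scaling by [d] gives the pairing with the coefficients of [u1] the scalar [d * c11 = 1]; the
   summand 0 below brings the vector into the shape of [coeff_conj]. *)
pose d := c11^-1.
have uf4 : fixed (d *: u1 + 0) by apply: fixP => //; exact: (fixed_linear a x0 pi).1.
have uf5 : fixed (1 *: (d *: u1 + 0) + (b *: u1 + u2)) by exact: fixP.
have T14 v w : ip (coeff uf1 v) (coeff uf4 w) = inner V v w.
  rewrite (coeff_conj _ _ uf1 (fixed_linear a x0 pi).1) dotDr dotZr c11E conjCK.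
  rewrite /d mulKf// [X in _ + X](_ : _ = 0) ?addr0//.
  suff -> : coeff (fixed_linear a x0 pi).1 w = 0 by exact: linear0r.
  by apply: (Cfun_orbitP (a := a) (x0 := x0)) => g; rewrite coeffE linear0 linear0r.
have T15 v w : ip (coeff uf1 v) (coeff uf5 w) = inner V v w.
  by rewrite (coeff_conj _ _ uf4 uf3) dotDr dotZr !conjC1 mul1r T14 T13 addr0.
have [||P _ PE] := acc (coeff uf1 @` setT).
- by exists n, (fun i => coeff uf1 (e i)); exact: coeff_span.
- by move=> g _ [v _ <-]; exists (pi g v) => //; exact: coeff_translate.
have Q4 := PE _ (coeff_projectionP eON eV T14).
have Q5 := PE _ (coeff_projectionP eON eV T15).
have [[w w0] _] := irr.
have [c33 c33E] := coeff_schur uf3 uf3.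
have c33_0 := coeff_schur_neq0 u30 c33E.
(* Both projections agree with [P], so injectivity of the coefficient map of [u1] equates the two
   adjoints at [coeff uf3 w]; yet their difference paired with [w] is [c33 * <w, w>], which is
   nonzero. *)
have := etrans (Q5 (coeff uf3 w)) (esym (Q4 (coeff uf3 w))).
rewrite !coeff_projectionE => /(coeff_inj u10) => H.
have : inner V (coeff_adjoint e uf5 (coeff uf3 w)) w =
    inner V (coeff_adjoint e uf4 (coeff uf3 w)) w by rewrite H.
rewrite !(coeff_adjointE eON eV) (coeff_conj _ _ uf4 uf3) dotDr dotZr !conjC1 mul1r.
rewrite -[RHS]addr0 => /addrI/eqP; rewrite c33E mulf_eq0 (negbTE c33_0).
by rewrite dnorm_eq0; exact/negP.
Qed.

End AccessibleMultiplicityFree.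

Theorem corollary1p11 (R : realType) (G : topologicalGroupType)
    (K : ptopologicalType) (a : transitive_action G K)
    (mu : probability (borel K) R) (x0 : K)
    (compactG : compact [set: G]) (hausdorffG : hausdorff_space G)
    (compactK : compact [set: K]) (hausdorffK : hausdorff_space K)
    (regular_mu : regular_measure mu) (invariant_mu : invariant_measure a mu) :
  multiplicity_free R a x0 <->
  (forall S : set (Cfun R K),
     finite_dim_subspace S -> invariant_subset a S -> accessible a mu S).
Proof.
split=> [MF S Sfin Sinv|acc V pi irr].
  exact: (multiplicity_free_accessible compactG compactK invariant_mu MF).
apply/dimension_le1; exact: accessible_fixed_dependent acc.
Qed.
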